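(* Let $r\geq 1$ be an integer, let $T=\langle \mathbf{p}_1,\mathbf{p}_2,\mathbf{p}_3\rangle\subset\mathbb{R}^2$ be a non-degenerate triangle, and let $\Delta_{\mathrm{PS}}$ be its uniform Powell--Sabin 6-split. Let $\mathcal{Q}$ be any symmetric quadrature rule on $T$ of type $[n_0,n_1,n_2]$ that is exact on $\mathbb{P}_{2r}$, i.e. $\mathcal{Q}(f)=\int_T f(\mathbf{x})\,d\mathbf{x}$ for all $f\in\mathbb{P}_{2r}$. Then $\mathcal{Q}$ is exact on the spline space $\mathbb{S}^{2r-1}_{2r}(\Delta_{\mathrm{PS}})$, i.e. $\mathcal{Q}(s)=\int_T s(\mathbf{x})\,d\mathbf{x}$ for all $s\in \mathbb{S}^{2r-1}_{2r}(\Delta_{\mathrm{PS}})$.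
   Context: $\langle\cdot\rangle$ denotes the convex hull, and $A(T)$ the area of $T$. $\mathbb{P}_d$ is the space of real bivariate polynomials of total degree at most $d$. Uniform Powell--Sabin split: let $\mathbf{p}_c:=\frac13(\mathbf{p}_1+\mathbf{p}_2+\mathbf{p}_3)$ be the barycenter of $T$ and let $\mathbf{p}_{1,2},\mathbf{p}_{2,3},\mathbf{p}_{3,1}$ be the midpoints of the edges $\langle\mathbf{p}_1,\mathbf{p}_2\rangle$, $\langle\mathbf{p}_2,\mathbf{p}_3\rangle$, $\langle\mathbf{p}_3,\mathbf{p}_1\rangle$. $\Delta_{\mathrm{PS}}$ is the triangulation of $T$ consisting of the six closed triangles $\langle \mathbf{p}_1,\mathbf{p}_{1,2},\mathbf{p}_c\rangle$, $\langle \mathbf{p}_{1,2},\mathbf{p}_2,\mathbf{p}_c\rangle$, $\langle \mathbf{p}_2,\mathbf{p}_{2,3},\mathbf{p}_c\rangle$, $\langle \mathbf{p}_{2,3},\mathbf{p}_3,\mathbf{p}_c\rangle$, $\langle \mathbf{p}_3,\mathbf{p}_{3,1},\mathbf{p}_c\rangle$, $\langle \mathbf{p}_{3,1},\mathbf{p}_1,\mathbf{p}_c\rangle$. Spline space: for a triangulation $\Delta$ of $T$, $\mathbb{S}^\rho_d(\Delta)$ is the space of functions $s:T\to\mathbb{R}$ of class $C^\rho$ on $T$ such that $s|_\tau\in\mathbb{P}_d$ for every triangle $\tau\in\Delta$. Symmetric quadrature rule: for a triple $\boldsymbol{\alpha}=(\alpha_1,\alpha_2,\alpha_3)$ with $\alpha_1+\alpha_2+\alpha_3=1$,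 let $\mathbf{t}(\boldsymbol{\alpha})=\alpha_1\mathbf{p}_1+\alpha_2\mathbf{p}_2+\alpha_3\mathbf{p}_3$ be the point with barycentric coordinates $\boldsymbol{\alpha}$ with respect to $T$, and let $\Pi\{\beta_1,\beta_2,\beta_3\}$ be the set of all distinct permutations of the triple $(\beta_1,\beta_2,\beta_3)$. A symmetric quadrature rule of type $[n_0,n_1,n_2]$ (with $n_0\in\{0,1\}$ and integers $n_1,n_2\geq0$) is a functional of the form $$\mathcal{Q}(f)=A(T)\Bigl(\omega_0 f\bigl(\mathbf{t}(\tfrac13,\tfrac13,\tfrac13)\bigr)+\sum_{i=1}^{n_1}\omega_{i,1}\sum_{\boldsymbol{\alpha}\in\Pi\{\theta_{i,1},\theta_{i,1},1-2\theta_{i,1}\}}f(\mathbf{t}(\boldsymbol{\alpha}))+\sum_{i=1}^{n_2}\omega_{i,2}\sum_{\boldsymbol{\alpha}\in\Pi\{\theta_{i,2},\eta_{i,2},1-\theta_{i,2}-\eta_{i,2}\}}f(\mathbf{t}(\boldsymbol{\alpha}))\Bigr),$$ with real weights, where the first term is absent if $n_0=0$, all nodes lie in $T$, $\theta_{i,1}\neq\frac13$, and $\theta_{i,2},\eta_{i,2},1-\theta_{i,2}-\eta_{i,2}$ are pairwise distinct. *)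

(* Defs.v *)
From HB Require Import structures.
From mathcomp Require Import all_boot all_order all_algebra.
From mathcomp Require Import all_classical all_reals all_analysis.
Import Order.TTheory GRing.Theory Num.Theory.
Import numFieldNormedType.Exports.

Set Implicit Arguments.
Unset Strict Implicit.
Unset Printing Implicit Defensive.

Local Open Scope classical_set_scope.
Local Open Scope ring_scope.

Section Defs.
Context {R : realType}.

Notation point := (R * R)%type.

Definition tri_point (p1 p2 p3 : point) (a : seq R) : point :=
  a`_0 *: p1 + a`_1 *: p2 + a`_2 *: p3.

Definition triangle (p1 p2 p3 : point) : set point :=
  [set x | exists a1 a2 a3 : R, [/\ 0 <= a1, 0 <= a2, 0 <= a3,
     a1 + a2 + a3 = 1 & x = tri_point p1 p2 p3 [:: a1; a2; a3]]].

Definition collinear (p1 p2 p3 : point) : Prop :=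
  exists (q v : point), forall p, [set p1; p2; p3] p ->
    exists t : R, p = q + t *: v.

Definition midpoint (p q : point) : point := 2^-1 *: (p + q).

Definition barycenter (p1 p2 p3 : point) : point := 3^-1 *: (p1 + p2 + p3).

Definition powell_sabin (p1 p2 p3 : point) : set (set point) :=
  let pc := barycenter p1 p2 p3 in
  let p12 := midpoint p1 p2 in
  let p23 := midpoint p2 p3 in
  let p31 := midpoint p3 p1 in
  [set triangle p1 p12 pc; triangle p12 p2 pc; triangle p2 p23 pc;
       triangle p23 p3 pc; triangle p3 p31 pc; triangle p31 p1 pc].

Definition polyfun_le (d : nat) : set (point -> R) :=
  [set f | exists c : nat -> nat -> R, forall x : point,
     f x = \sum_(i < d.+1) \sum_(j < d.+1 | (i + j <= d)%N)
             c i j * x.1 ^+ i * x.2 ^+ j].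

(* f is of class C^k on the closed set D: all partial derivatives of order at
   most k exist in the interior of D and extend continuously to D.  Here g1 and
   g2 are the continuous extensions of the first-order partial derivatives.
   Only the values of f on D matter. *)
Fixpoint class_C (k : nat) (D : set point) (f : point -> R) : Prop :=
  {within D, continuous f} /\
  if k is k'.+1 then
    exists g1 g2 : point -> R,
      [/\ forall x : point, D^° x -> is_derive x ((1, 0) : point) f (g1 x),
          forall x : point, D^° x -> is_derive x ((0, 1) : point) f (g2 x),
          class_C k' D g1 & class_C k' D g2]
  else True.

(* Functions on D are represented by total functions, of which only the
   restriction to D is constrained. *)
Definition spline_space (rho d : nat) (D : set point)
    (Delta : set (set point)) : set (point -> R) :=
  [set s | class_C rho D s /\
     forall tau, Delta tau -> exists2 f, polyfun_le d f & {in tau, s =1 f}].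

Definition lebesgue2 := (@lebesgue_measure R \x @lebesgue_measure R)%E.

Definition area (D : set point) : R := fine (lebesgue2 D).

Definition exact_on (D : set point) (Q : (point -> R) -> R)
    (S : set (point -> R)) : Prop :=
  forall f, S f -> (Q f)%:E = (\int[lebesgue2]_(x in D) (f x)%:E)%E.

(* [permutations s] is the duplicate-free list of the permutations of s. *)
Definition symmetric_quadrature_rule (p1 p2 p3 : point) (n0 n1 n2 : nat)
    (Q : (point -> R) -> R) : Prop :=
  let T := triangle p1 p2 p3 in
  let t := tri_point p1 p2 p3 in
  let orbit1 (th : R) : seq (seq R) := permutations [:: th; th; 1 - 2 * th] in
  let orbit2 (th et : R) : seq (seq R) := permutations [:: th; et; 1 - th - et] in
  (n0 <= 1)%N /\
  exists (w0 : 'I_n0 -> R) (w1 th1 : 'I_n1 -> R) (w2 th2 et2 : 'I_n2 -> R),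
  [/\ forall i, th1 i != 3^-1,
      forall i, uniq [:: th2 i; et2 i; 1 - th2 i - et2 i],
      forall i (a : seq R), a \in orbit1 (th1 i) -> T (t a),
      forall i (a : seq R), a \in orbit2 (th2 i) (et2 i) -> T (t a) &
      forall f, Q f = area T *
        (\sum_(i < n0) w0 i * f (t [:: 3^-1; 3^-1; 3^-1])
         + \sum_(i < n1) w1 i * (\sum_(a <- orbit1 (th1 i)) f (t a))
         + \sum_(i < n2) w2 i * (\sum_(a <- orbit2 (th2 i) (et2 i)) f (t a)))].

End Defs.

(* Main.v *)
Require Import Defs.
From mathcomp Require Import all_boot all_order all_algebra.
From mathcomp Require Import all_classical all_reals all_analysis.
From mathcomp Require Import measurable_realfun ring lra.
Import Order.TTheory GRing.Theory Num.Theory.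
Import numFieldNormedType.Exports.

(** The medians cut the triangle T into the six pieces of the split, and the six
    affine symmetries of T permute these pieces.  A symmetric quadrature rule and
    the integral over T are both invariant under the symmetries, so that for a
    spline s and the sum S of its six composites s \o g one has Q S = 6 Q s and
    the integral of S is 6 times that of s.  It therefore suffices to see that S
    agrees on T with a polynomial F of degree at most 2r (symmetrize_pieces), for
    which the rule is exact.

    The candidate is F = sum of the f_g \o g, where f_g is the polynomial of s on
    the image by g of a fixed piece, the chamber.  On the chamber F and S agree,
    and S is invariant under the symmetries, so everything rests on the invariance
    of F, which need only be checked for the two reflections e that fix a wall of
    the chamber.  Right multiplication by e pairs g with g e, whose pieces are
    adjacent along the image of that wall.  Let h = f_g - f_(g e).  As s is of
    class C^(2r-1), at a point m of the common wall all derivatives of h of order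
    at most 2r-1 vanish (contact_coef), so that h (m + t v) is a multiple of
    t^(2r): h is even about m (contact_even).  Being even about every point of a
    segment, h is even about every point of the line that carries it
    (even_about_line), and the affine reflection about that line moves each point
    to its mirror image about a point of the line.  Thus h is invariant under this
    reflection (wall_symmetric), that is, f_g \o g + f_(g e) \o g \o e is invariant
    under e, and so is the sum F of three such terms.

    The invariance of the integral is the fact that an affine reflection
    x + l(x) w, with l(w) = -2 for the linear part, preserves area: it is a product
    of maps that act by isometries on the lines parallel to an axis
    (area_preserving_reflection). *)

Set Implicit Arguments.
Unset Strict Implicit.
Unset Printing Implicit Defensive.

Local Open Scope classical_set_scope.
Local Open Scope ring_scope.

(** * Coordinates in the plane *)

Section Coordinates.
Context {R : realType}.

Lemma plane_ext (x y : R * R) : x.1 = y.1 -> x.2 = y.2 -> x = y.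
Proof. by case: x y => [? ?] [? ?] /= -> ->. Qed.

Lemma fst_add (x y : R * R) : (x + y).1 = x.1 + y.1. Proof. by []. Qed.
Lemma snd_add (x y : R * R) : (x + y).2 = x.2 + y.2. Proof. by []. Qed.
Lemma fst_opp (x : R * R) : (- x).1 = - x.1. Proof. by []. Qed.
Lemma snd_opp (x : R * R) : (- x).2 = - x.2. Proof. by []. Qed.
Lemma fst_scale (t : R) (x : R * R) : (t *: x).1 = t * x.1. Proof. by []. Qed.
Lemma snd_scale (t : R) (x : R * R) : (t *: x).2 = t * x.2. Proof. by []. Qed.
Definition coordE :=
  (fst_add, snd_add, fst_opp, snd_opp, fst_scale, snd_scale).
End Coordinates.

(** * Area-preserving affine maps *)

Section AreaPreserving.
Context {R : realType}.
Local Notation line := (measurableTypeR R).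
Local Notation plane := (line * line)%type.
Local Notation leb := (@lebesgue_measure R).

(** Both measures give b - a to every interval ]a, b], and Lebesgue measure is
    determined by these values. *)
Lemma lebesgue_measure_translate (c : R) (A : set R) :
  measurable (A : set line) -> leb ((fun x => x + c) @^-1` A) = leb A.
Proof.
move=> mA.
have mf : measurable_fun [set: line] ((fun x => x + c) : line -> line).
  exact: measurable_funD.
suff: leb A = pushforward leb ((fun x => x + c) : line -> line) A by move=> ->.
apply: lebesgue_measure_unique mA => _ [[a b]] _ <- /=.
transitivity (leb ((fun x => x + c) @^-1` `]a, b]%classic)); last by [].
rewrite (_ : _ @^-1` _ = `](a - c), (b - c)]%classic); last first.
  by apply/seteqP; split=> x /=; rewrite !in_itv /= ltrBlDr lerBrDr.
rewrite !lebesgue_measure_itv/= !lte_fin ltrD2r -!EFinB.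
by case: ifP => // _; congr EFin; ring.
Qed.

Lemma lebesgue_measure_unit_affine (e c : R) (A : set R) : e = 1 \/ e = -1 ->
  measurable (A : set line) -> leb ((fun x => e * x + c) @^-1` A) = leb A.
Proof.
move=> e1 mA.
have mc : measurable ((fun x => x + c) @^-1` A : set line).
  have mf : measurable_fun [set: line] ((fun x => x + c) : line -> line).
    exact: measurable_funD.
  by rewrite -[X in measurable X]setTI; exact: mf.
case: e1 => ->.
  by under eq_fun do rewrite mul1r; exact: lebesgue_measure_translate.
under eq_fun do rewrite mulN1r.
rewrite -[RHS](lebesgue_measure_translate c mA) -[RHS](lebesgue_measureN mc).
by [].
Qed.

Definition area_preserving (g : R * R -> R * R) :=
  measurable_fun [set: plane] (g : plane -> plane) /\
  forall A : set plane, measurable A -> lebesgue2 (g @^-1` A) = lebesgue2 A.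

Lemma area_preserving_comp g h :
  area_preserving g -> area_preserving h -> area_preserving (g \o h).
Proof.
move=> [mg g2] [mh h2]; split; first exact: measurableT_comp mg mh.
move=> A mA; rewrite comp_preimage h2 ?g2//.
by rewrite -[X in measurable X]setTI; apply: mg.
Qed.

Lemma measurable_affine_form (a b c : R) :
  measurable_fun [set: plane] (fun x : plane => a * x.1 + b * x.2 + c : R).
Proof.
by do ![apply: measurable_funD | apply: measurable_funM].
Qed.

(** Tonelli by slices: on each vertical line the map is a translation, possibly
    composed with a reflection, so every vertical section keeps its length. *)
Lemma area_preserving_shear2 (e k c : R) : e = 1 \/ e = -1 ->
  area_preserving (fun x => (x.1, e * x.2 + (k * x.1 + c))).
Proof.
move=> e1; set g := (fun x => _).
have mg : measurable_fun [set: plane] (g : plane -> plane).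
  apply/measurable_fun_pair; first exact: measurable_fst.
  under eq_fun do rewrite addrA [e * _ + _]addrC; exact: measurable_affine_form.
split=> // A mA; rewrite /lebesgue2 /product_measure1; apply: eq_integral => x _ /=.
rewrite -[RHS](lebesgue_measure_unit_affine (k * x + c) e1); last first.
  exact: measurable_xsection.
by congr (leb _); apply/seteqP; split => y /=; rewrite /xsection /= !inE.
Qed.

(** The same argument by horizontal slices, which uses that the product measure
    may be computed by integrating over either factor first. *)
Lemma area_preserving_shear1 (e k c : R) : e = 1 \/ e = -1 ->
  area_preserving (fun x => (e * x.1 + (k * x.2 + c), x.2)).
Proof.
move=> e1; set g := (fun x => _).
have mg : measurable_fun [set: plane] (g : plane -> plane).
  apply/measurable_fun_pair; last exact: measurable_snd.
  under eq_fun do rewrite addrA; exact: measurable_affine_form.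
have lebE (A : set plane) : measurable A -> lebesgue2 A = (leb \x^ leb)%E A.
  by apply: product_measure_unique => //= *; rewrite product_measure2E.
split=> // A mA.
have mgA : measurable (g @^-1` A : set plane).
  by rewrite -[X in measurable X]setTI; apply: mg.
rewrite !lebE// /product_measure2; apply: eq_integral => y _ /=.
rewrite -[RHS](lebesgue_measure_unit_affine (k * y + c) e1); last first.
  exact: measurable_ysection.
by congr (leb _); apply/seteqP; split => x /=; rewrite /ysection /= !inE.
Qed.

(** With l the linear part of the coefficient, l(w) = -2 says that the map is the
    affine reflection in direction w about the line on which the coefficient
    vanishes.  A shear turning w into the vertical direction conjugates it into
    a map that acts on each vertical line as a reflection, so it is a product of
    three shears; if w is horizontal, the map already is one. *)
Lemma area_preserving_reflection (w : R * R) (l1 l2 l0 : R) :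
  l1 * w.1 + l2 * w.2 = -2 ->
  area_preserving (fun x => x + (l1 * x.1 + l2 * x.2 + l0) *: w).
Proof.
move=> lw.
have [w20|w20] := eqVneq w.2 0.
  rewrite (_ : (fun x => _) =
    fun x => (-1 * x.1 + (w.1 * l2 * x.2 + w.1 * l0), x.2)).
    by apply: area_preserving_shear1; right.
  apply/funext => x; apply: plane_ext; rewrite !coordE /= ?w20 ?mulr0 ?addr0//.
  by move: lw; rewrite w20 => lw; ring: lw.
(* C (- k) is the shear that sends w to (0, w.2). *)
pose k := w.1 / w.2.
have kw : k * w.2 = w.1 by rewrite /k divfK.
pose C e := (fun x : R * R => (1 * x.1 + (e * x.2 + 0), x.2)).
pose D := (fun x : R * R => (x.1, -1 * x.2 + (l1 * w.2 * x.1 + l0 * w.2))).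
rewrite (_ : (fun x => _) = C k \o (D \o C (- k))).
  apply: area_preserving_comp; first by apply: area_preserving_shear1; left.
  apply: area_preserving_comp; first by apply: area_preserving_shear2; right.
  by apply: area_preserving_shear1; left.
have lw2 : l2 * w.2 = - 2 - l1 * k * w.2 by rewrite -mulrA kw -lw; ring.
apply/funext => x; apply: plane_ext; rewrite /C /D !coordE /= -?kw.
  by ring: lw2.
by ring: lw2.
Qed.
(** The same set function as lebesgue2, with its structure of measure, which the
    integration theorems expect. *)
Definition lebesgue2_measure : {measure set plane -> \bar R} :=
  (@lebesgue_measure R \x @lebesgue_measure R)%E.

Lemma integral_area_preserving_ge0 (D : set plane) (g : R * R -> R * R)
    (k : plane -> \bar R) :
  area_preserving g -> measurable D -> measurable_fun D k -> (forall x, 0 <= k x)%E ->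
    (\int[lebesgue2]_(x in D) k x = \int[lebesgue2]_(x in g @^-1` D) k (g x))%E.
Proof.
move=> [mg gE] mD mk k0.
apply: etrans (@ge0_integral_pushforward _ _ plane plane R g mg
  lebesgue2_measure D k mD mk (fun x _ => k0 x)).
apply: eq_measure_integral => A mA _.
by rewrite -[LHS]gE.
Qed.

Lemma integral_area_preserving (D : set plane) (g : R * R -> R * R)
    (f : R * R -> R) :
  area_preserving g -> measurable D -> measurable_fun D (f : plane -> R) ->
  (\int[lebesgue2]_(x in D) (f x)%:E =
   \int[lebesgue2]_(x in g @^-1` D) (f (g x))%:E)%E.
Proof.
move=> pg mD mf.
have mfE : measurable_fun D (fun x : plane => (f x)%:E) by exact/measurable_EFinP.
(* Naming f as an extended-real function lets its positive and negative parts
   commute with the composition by g. *)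
pose F := fun x : plane => (f x)%:E.
transitivity (\int[lebesgue2]_(x in g @^-1` D) (F \o g) x)%E; last by [].
rewrite integralE [RHS]integralE (funepos_comp F g) (funeneg_comp F g).
congr (_ - _)%E.
  exact: (integral_area_preserving_ge0 pg mD (measurable_funepos mfE)
    (funepos_ge0 _)).
exact: (integral_area_preserving_ge0 pg mD (measurable_funeneg mfE)
  (funeneg_ge0 _)).
Qed.
End AreaPreserving.

(** * Bivariate polynomials of bounded degree *)

Section Polynomials.
Context {R : realType}.
Implicit Types (f g : R * R -> R) (d : nat) (x m v : R * R).

(** The functions of polyfun_le, presented by sums and by products with affine
    forms rather than by coefficients.  The class is then visibly stable under
    affine substitution, which is opaque on coefficients, and facts about
    polynomials follow by induction; polyfun_leW and poly_le_polyfun translate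
    between the two presentations. *)
Inductive poly_le : nat -> (R * R -> R) -> Prop :=
| poly_cst d k : poly_le d (fun=> k)
| poly_add d f g : poly_le d f -> poly_le d g -> poly_le d (fun x => f x + g x)
| poly_mul d a b c f : poly_le d f ->
    poly_le d.+1 (fun x => (a * x.1 + b * x.2 + c) * f x).

Lemma poly_le_weaken d d' f : (d <= d')%N -> poly_le d f -> poly_le d' f.
Proof.
move=> dd' pf; elim: pf d' dd' => {d f} [d k|d f g _ IHf _ IHg|d a b c f _ IHf] d' dd'.
- exact: poly_cst.
- by apply: poly_add; [exact: IHf|exact: IHg].
- by case: d' dd' => // d' dd'; apply: poly_mul; exact: IHf.
Qed.

Lemma poly_le_scale d k f : poly_le d f -> poly_le d (fun x => k * f x).
Proof.
elim=> {d f} [d c|d f g _ IHf _ IHg|d a b c f _ IHf].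
- exact: poly_cst.
- by under eq_fun do rewrite mulrDr; exact: poly_add.
- by under eq_fun do rewrite mulrCA; exact: poly_mul.
Qed.

Lemma poly_le_sum (I : Type) (s : seq I) (P : pred I) d (F : I -> R * R -> R) :
  (forall i, P i -> poly_le d (F i)) ->
  poly_le d (fun x => \sum_(i <- s | P i) F i x).
Proof.
move=> pF; elim: s => [|i s IHs].
  by under eq_fun do rewrite big_nil; exact: poly_cst.
under eq_fun do rewrite big_cons.
by case: (boolP (P i)) => // Pi; apply: poly_add => //; exact: pF.
Qed.

Lemma poly_le_monomial i j : poly_le (i + j) (fun x => x.1 ^+ i * x.2 ^+ j).
Proof.
elim: i => [|i IHi].
  elim: j => [|j IHj]; first by under eq_fun do rewrite !expr0; exact: poly_cst.
  rewrite (_ : (fun _ => _) =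
    fun x : R * R => (0 * x.1 + 1 * x.2 + 0) * (x.1 ^+ 0 * x.2 ^+ j)).
    exact: poly_mul.
  by apply/funext => x; rewrite exprS; ring.
rewrite (_ : (fun _ => _) =
  fun x : R * R => (1 * x.1 + 0 * x.2 + 0) * (x.1 ^+ i * x.2 ^+ j)).
  exact: poly_mul.
by apply/funext => x; rewrite exprS; ring.
Qed.

Lemma polyfun_leW d f : polyfun_le d f -> poly_le d f.
Proof.
move=> [c fE]; rewrite (funext fE).
apply: poly_le_sum => i _; apply: poly_le_sum => j ij.
under eq_fun do rewrite -mulrA; apply: poly_le_scale.
exact: poly_le_weaken ij (poly_le_monomial i j).
Qed.

Lemma polyfun_leD d f g : polyfun_le d f -> polyfun_le d g ->
  polyfun_le d (fun x => f x + g x).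
Proof.
move=> [c fE] [c' gE]; exists (fun i j => c i j + c' i j) => x.
rewrite fE gE -big_split /=; apply: eq_bigr => i _; rewrite -big_split /=.
by apply: eq_bigr => j _; ring.
Qed.

Lemma polyfun_leZ d k f : polyfun_le d f -> polyfun_le d (fun x => k * f x).
Proof.
move=> [c fE]; exists (fun i j => k * c i j) => x.
rewrite fE mulr_sumr; apply: eq_bigr => i _; rewrite mulr_sumr.
by apply: eq_bigr => j _; ring.
Qed.

Lemma polyfun_le_cst d k : polyfun_le d (fun=> k : R).
Proof.
exists (fun i j => if (i == 0%N) && (j == 0%N) then k else 0) => x.
rewrite big_ord_recl big_mkcond big_ord_recl /= !mulr1.
rewrite big1 ?addr0; last by move=> j _; rewrite !mul0r; case: ifP.
by rewrite big1 ?addr0// => i _; rewrite big1// => j _; rewrite !mul0r.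
Qed.

Lemma polyfun_leS d f : polyfun_le d f -> polyfun_le d.+1 f.
Proof.
move=> [c fE].
exists (fun i j => if (i + j <= d)%N then c i j else 0) => x.
rewrite fE [RHS]big_ord_recr [X in _ = _ + X]big1 ?addr0; last first.
  move=> j _ /=; case: ifP; last by rewrite !mul0r.
  by move/(leq_trans (leq_addr _ _)); rewrite ltnn.
apply: eq_bigr => i _; rewrite big_mkcond [RHS]big_mkcond [RHS]big_ord_recr /=.
rewrite [X in _ = _ + X](_ : _ = 0) ?addr0; last first.
  case: ifP => // _; case: ifP; last by rewrite !mul0r.
  by move/(leq_trans (leq_addl _ _)); rewrite ltnn.
apply: eq_bigr => j _; case: ifP => [ij|]; first by rewrite leqW.
by case: ifP => //; rewrite !mul0r.
Qed.

Lemma polyfun_leMx d f : polyfun_le d f -> polyfun_le d.+1 (fun x => x.1 * f x).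
Proof.
move=> [c fE].
exists (fun i j => if i is i'.+1 then c i' j else 0) => x.
rewrite fE [RHS]big_ord_recl [X in _ = X + _]big1 ?add0r; last first.
  by move=> j _ /=; rewrite !mul0r.
rewrite mulr_sumr; apply: eq_bigr => i _ /=.
rewrite big_mkcond [RHS]big_mkcond [RHS]big_ord_recr /= mulr_sumr.
rewrite [X in _ = _ + X](_ : _ = 0) ?addr0; last first.
  case: ifP => //; rewrite /bump /= add1n addSn ltnS.
  by move/(leq_trans (leq_addl _ _)); rewrite ltnn.
apply: eq_bigr => j _; rewrite /bump /= add1n addSn ltnS.
by case: ifP => _; [rewrite exprS; ring | rewrite mulr0].
Qed.

Lemma polyfun_leMy d f : polyfun_le d f -> polyfun_le d.+1 (fun x => x.2 * f x).
Proof.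
move=> [c fE].
exists (fun i j => if j is j'.+1 then c i j' else 0) => x.
rewrite fE [RHS]big_ord_recr [X in _ = _ + X]big1 ?addr0; last first.
  move=> [[|j] jd] /=; rewrite ?mul0r//.
  by rewrite addnS ltnNge leq_addr.
rewrite mulr_sumr; apply: eq_bigr => i _ /=.
rewrite big_mkcond [RHS]big_mkcond [RHS]big_ord_recl /= mulr_sumr !mul0r.
rewrite [X in _ = X + _](_ : _ = 0) ?add0r; last by case: ifP.
apply: eq_bigr => j _; rewrite /bump /= add1n addnS ltnS.
by case: ifP => _; [rewrite exprS; ring | rewrite mulr0].
Qed.

Lemma poly_le_polyfun d f : poly_le d f -> polyfun_le d f.
Proof.
elim=> {d f} [d k|d f g _ IHf _ IHg|d a b c f _ IHf].
- exact: polyfun_le_cst.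
- exact: polyfun_leD.
- rewrite (_ : (fun _ => _) =
    fun x => (a * (x.1 * f x) + b * (x.2 * f x)) + c * f x).
    apply: polyfun_leD; last exact/polyfun_leZ/polyfun_leS.
    by apply: polyfun_leD; apply: polyfun_leZ;
    [exact: polyfun_leMx|exact: polyfun_leMy].
  by apply/funext => x; ring.
Qed.

Definition affine_map (h : R * R -> R * R) := exists a b c a' b' c' : R,
  forall x, h x = (a * x.1 + b * x.2 + c, a' * x.1 + b' * x.2 + c').

Lemma poly_le_affine d f h : affine_map h -> poly_le d f -> poly_le d (f \o h).
Proof.
move=> [a1 [b1 [c1 [a2 [b2 [c2 hE]]]]]].
elim=> {d f} [d k|d f g _ IHf _ IHg|d a b c f _ IHf].
- exact: poly_cst.
- exact: poly_add IHf IHg.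
- rewrite (_ : _ \o h = fun x => ((a * a1 + b * a2) * x.1 +
    (a * b1 + b * b2) * x.2 + (a * c1 + b * c2 + c)) * (f \o h) x).
    exact: poly_mul.
  by apply/funext => x /=; rewrite hE /=; ring.
Qed.

Lemma affine_map_comp h k : affine_map h -> affine_map k -> affine_map (h \o k).
Proof.
move=> [a1 [b1 [c1 [a2 [b2 [c2 hE]]]]]] [a3 [b3 [c3 [a4 [b4 [c4 kE]]]]]].
exists (a1 * a3 + b1 * a4), (a1 * b3 + b1 * b4), (a1 * c3 + b1 * c4 + c1).
exists (a2 * a3 + b2 * a4), (a2 * b3 + b2 * b4), (a2 * c3 + b2 * c4 + c2) => x.
by rewrite /= kE hE /=; congr pair; ring.
Qed.

Lemma is_derive_affine_form (a b c : R) x v :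
  is_derive x v (fun y : R * R => a * y.1 + b * y.2 + c : R) (a * v.1 + b * v.2).
Proof.
pose l := fun y : R * R => a * y.1 + b * y.2 + c : R.
have cvgl : (fun h : R => h^-1 *: ((l \o shift x) (h *: v) - l x)) @ 0^' -->
    a * v.1 + b * v.2.
  (* The difference quotient of an affine form is constant. *)
  apply: cvg_near_cst; near=> h; rewrite /l /shift /=.
  rewrite -[LHS]/(h^-1 * (a * (h * v.1 + x.1) + b * (h * v.2 + x.2) + c
    - (a * x.1 + b * x.2 + c))).
  have h0 : h != 0 by near: h; exact: nbhs_dnbhs_neq.
  by field.
by apply: DeriveDef; [apply/cvg_ex; eexists; exact: cvgl|exact: cvg_lim cvgl].
Unshelve. all: by end_near. Qed.

(** The two partial derivatives f1 and f2 are again polynomials of the class, and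
    on each line m + t v the function is a univariate polynomial p in t whose
    formal derivative is given by the chain rule.  This is the link between the
    analytic derivatives in the definition of C^k and the algebra of
    univariate polynomials. *)
Lemma poly_le_gradient d f : poly_le d f -> exists f1 f2,
  [/\ poly_le d f1, poly_le d f2,
      forall x, is_derive x ((1, 0) : R * R) f (f1 x),
      forall x, is_derive x ((0, 1) : R * R) f (f2 x) &
      forall m v, exists p : {poly R}, [/\ (size p <= d.+1)%N,
        forall t, f (m + t *: v) = p.[t] &
        forall t, v.1 * f1 (m + t *: v) + v.2 * f2 (m + t *: v) = p^`().[t]]].
Proof.
elim=> {d f} [d k|d f g _ [f1 [f2 [pf1 pf2 df1 df2 fP]]] _
  [g1 [g2 [pg1 pg2 dg1 dg2 gP]]]|d a b c f pf [f1 [f2 [pf1 pf2 df1 df2 fP]]]].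
- exists (fun=> 0), (fun=> 0); split; [exact: poly_cst|exact: poly_cst| | |].
  + by move=> x; exact: is_derive_cst.
  + by move=> x; exact: is_derive_cst.
  + move=> m v; exists k%:P; split=> [|t|t]; last by rewrite derivC horner0; ring.
    * by rewrite (leq_trans (size_polyC_leq1 _)).
    * by rewrite hornerC.
- exists (fun x => f1 x + g1 x), (fun x => f2 x + g2 x).
  split; [exact: poly_add|exact: poly_add| | |].
  + by move=> x; exact: is_deriveD.
  + by move=> x; exact: is_deriveD.
  + move=> m v; have [p [sp pE dpE]] := fP m v; have [q [sq qE dqE]] := gP m v.
    exists (p + q); split=> [|t|t].
    * by rewrite (leq_trans (size_polyD _ _))// geq_max sp.
    * by rewrite hornerD pE qE.
    * by rewrite derivD hornerD -dpE -dqE; ring.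
- pose l (x : R * R) := a * x.1 + b * x.2 + c.
  exists (fun x => a * f x + l x * f1 x), (fun x => b * f x + l x * f2 x); split.
  + apply: poly_add; last exact: poly_mul.
    exact/poly_le_scale/poly_le_weaken/pf.
  + apply: poly_add; last exact: poly_mul.
    exact/poly_le_scale/poly_le_weaken/pf.
  + move=> x; apply: is_derive_eq.
      exact: (is_deriveM (is_derive_affine_form a b c x (1, 0)) (df1 x)).
    by rewrite /l /GRing.scale /=; ring.
  + move=> x; apply: is_derive_eq.
      exact: (is_deriveM (is_derive_affine_form a b c x (0, 1)) (df2 x)).
    by rewrite /l /GRing.scale /=; ring.
  + move=> m v; have [p [sp pE dpE]] := fP m v.
    exists (((a * v.1 + b * v.2)%:P * 'X + (l m)%:P) * p); split=> [|t|t].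
    * rewrite (leq_trans (size_polyMleq _ _))// -subn1 leq_subLR addnS.
      apply: (@leq_add _ _ 2) sp; rewrite size_MXaddC; case: ifP => // _.
      by rewrite ltnS size_polyC_leq1.
    * by rewrite hornerM hornerD hornerM hornerX !hornerC pE /l !coordE; ring.
    * rewrite derivM derivD derivM derivX !derivC mul0r add0r mulr1 addr0.
      rewrite hornerD !hornerM hornerD hornerM hornerX !hornerC -dpE -pE /l.
      by rewrite !coordE; ring.
Qed.

Lemma poly_le_measurable d f : poly_le d f ->
  measurable_fun [set: (measurableTypeR R * measurableTypeR R)%type] f.
Proof.
elim=> {d f} [d k|d f g _ IHf _ IHg|d a b c f _ IHf].
- exact: measurable_cst.
- exact: measurable_funD.
- by apply: measurable_funM => //; exact: measurable_affine_form.
Qed.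

Lemma affine_map_measurable h : affine_map h ->
  measurable_fun [set: (measurableTypeR R * measurableTypeR R)%type]
    (h : _ -> (measurableTypeR R * measurableTypeR R)%type).
Proof.
move=> [a1 [b1 [c1 [a2 [b2 [c2 hE]]]]]]; rewrite (funext hE).
by apply: measurable_fun_pair; exact: measurable_affine_form.
Qed.

(** On a triangle an affine form is a convex combination of its values at the
    vertices; boundedness propagates through sums and products. *)
Lemma poly_le_bounded p1 p2 p3 d f : poly_le d f ->
  exists M, forall x, triangle p1 p2 p3 x -> `|f x| <= M.
Proof.
elim=> {d f} [d k|d f g _ [Mf IHf] _ [Mg IHg]|d a b c f _ [M IHf]].
- by exists `|k|.
- exists (Mf + Mg) => x Tx; rewrite (le_trans (ler_normD _ _))// lerD//.
    exact: IHf.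
  exact: IHg.
pose l (x : R * R) := a * x.1 + b * x.2 + c.
exists ((`|l p1| + `|l p2| + `|l p3|) * M) => x Tx.
rewrite normrM ler_pM// ?IHf//.
case: Tx => a1 [a2 [a3 [a10 a20 a30 a123 ->]]].
rewrite (_ : _ + c = a1 * l p1 + a2 * l p2 + a3 * l p3); last first.
  by rewrite /l /tri_point !coordE /= -[in LHS](mul1r c) -a123; ring.
have h k y : 0 <= k -> k <= 1 -> `|k * l y| <= `|l y|.
  by move=> k0 k1; rewrite normrM ger0_norm// ler_piMl.
rewrite (le_trans (ler_normD _ _))// lerD ?h//; last by lra.
by rewrite (le_trans (ler_normD _ _))// lerD ?h//; lra.
Qed.
End Polynomials.

(** * Contact of polynomial pieces of a smooth function *)

Section Contact.
Context {R : realType}.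
Implicit Types (f : R * R -> R) (d k : nat) (x m v : R * R) (p : {poly R}).

Lemma horner_inj p q : (forall t, p.[t] = q.[t]) -> p = q.
Proof.
move=> pq; apply/eqP; rewrite -subr_eq0; apply/eqP.
apply: (@roots_geq_poly_eq0 _ _ [seq i%:R | i <- iota 0 (size (p - q))]).
- by apply/allP => t _; rewrite /root hornerD hornerN pq subrr.
- by rewrite map_inj_uniq ?iota_uniq// => i j /eqP; rewrite eqr_nat => /eqP.
- by rewrite size_map size_iota.
Qed.

(** A half-open segment inside U ends at m: values at m of continuous functions are
    then limits along this segment of their values on U, where derivatives of
    pieces may be taken. *)
Definition reaches (U : set (R * R)) m := open U /\
  exists q, forall t : R, 0 < t -> t <= 1 -> U (m + t *: (q - m)).

(** Both sides are limits, along the segment inside U that ends at m, of functions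
    that agree there. *)
Lemma eq_at_boundary (D U : set (R * R)) m s d f :
  {within D, continuous s} -> D m -> U `<=` D -> reaches U m ->
  poly_le d f -> {in U, s =1 f} -> s m = f m.
Proof.
move=> /subspace_continuousP cs Dm UD [_ [q Uq]] pf sf.
have [f1 [f2 [_ _ _ _ fP]]] := poly_le_gradient pf.
have [p [_ pE _]] := fP m (q - m).
pose path (t : R) := m + t *: (q - m).
have path0 : path t @[t --> 0^'+] --> m.
  rewrite -[X in _ --> X]addr0 -[X in _ + X](scale0r (q - m)).
  apply: cvgD; first exact: cvg_cst.
  by apply: cvgZr_tmp; exact: cvg_at_right_filter.
have near_path : \forall t \near 0^'+, U (path t).
  near=> t; apply: Uq; near: t; [exact: nbhs_right_gt|exact: nbhs_right_le].
have spath : s (path t) @[t --> 0^'+] --> s m.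
  apply: cvg_comp (cs m Dm) => A DA.
  by apply: filterS2 near_path (path0 _ DA) => t /UD Dt; exact.
have fpath : p.[t] @[t --> 0^'+] --> f m.
  have -> : f m = p.[0] by rewrite -pE scale0r addr0.
  apply: cvg_at_right_filter; exact: continuous_horner.
have spath' : s (path t) @[t --> 0^'+] --> f m.
  apply: cvg_trans fpath; apply: near_eq_cvg; near=> t.
  by rewrite sf ?pE// inE; near: t.
by rewrite -(cvg_lim (@Rhausdorff R) spath) (cvg_lim (@Rhausdorff R) spath').
Unshelve. all: by end_near. Qed.

Lemma derivative_on_open (D U : set (R * R)) s g e f f' :
  (forall x, D^° x -> is_derive x e s (g x)) -> U `<=` D -> open U ->
  {in U, s =1 f} -> (forall x, is_derive x e f (f' x)) -> {in U, g =1 f'}.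
Proof.
move=> sg UD oU sf ff' x; rewrite inE => Ux.
have Dx : D^° x by apply: filterS UD _; exact: open_nbhs_nbhs.
have [_ <-] := sg x Dx; have [_ <-] := ff' x.
apply: near_eq_derive; near=> y; apply: sf; rewrite inE; near: y.
exact: open_nbhs_nbhs.
Unshelve. all: by end_near. Qed.

(** Two polynomial pieces of a C^k function that meet at m have contact of order
    k there: on each line through m their difference p has no coefficient of
    degree at most k.  By induction on k: the constant coefficient vanishes
    because the values agree at m, and the coefficients of p' are combinations
    of those of the differences of partial derivatives, to which the induction
    hypothesis applies since they are the pieces of the C^(k-1) extensions of
    the partial derivatives of s. *)
Lemma contact_coef k (D U1 U2 : set (R * R)) m s d f1 f2 v p :
  class_C k D s -> D m -> U1 `<=` D -> U2 `<=` D -> reaches U1 m -> reaches U2 m ->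
  poly_le d f1 -> poly_le d f2 -> {in U1, s =1 f1} -> {in U2, s =1 f2} ->
  (forall t, f1 (m + t *: v) - f2 (m + t *: v) = p.[t]) ->
  forall i, (i <= k)%N -> p`_i = 0.
Proof.
move=> Cs Dm U1D U2D rU1 rU2.
elim: k s f1 f2 p Cs => [|k IHk] s f1 f2 p [cs Cs] pf1 pf2 sf1 sf2 pE.
all: have p0 : p`_0 = 0 by
  rewrite -horner_coef0 -pE scale0r addr0 -(eq_at_boundary cs Dm U1D rU1 pf1 sf1)
          (eq_at_boundary cs Dm U2D rU2 pf2 sf2) subrr.
  by case.
case=> // i ik.
case: Cs => g1 [g2 [sg1 sg2 Cg1 Cg2]].
have [f11 [f12 [pf11 pf12 df11 df12 f1P]]] := poly_le_gradient pf1.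
have [f21 [f22 [pf21 pf22 df21 df22 f2P]]] := poly_le_gradient pf2.
have [q1 [_ q1E dq1E]] := f1P m v; have [q2 [_ q2E dq2E]] := f2P m v.
have pq : p = q1 - q2 by apply: horner_inj => t; rewrite -pE q1E q2E hornerD hornerN.
have line_poly f : poly_le d f -> exists q : {poly R}, forall t, f (m + t *: v) = q.[t].
  by move=> /poly_le_gradient[h1 [h2 [_ _ _ _ /(_ m v)[q [_ qE _]]]]]; exists q.
have [a1 a1E] := line_poly _ pf11; have [a2 a2E] := line_poly _ pf21.
have [b1 b1E] := line_poly _ pf12; have [b2 b2E] := line_poly _ pf22.
have oU1 := rU1.1; have oU2 := rU2.1.
have a0 : (a1 - a2)`_i = 0.
  apply: (IHk g1 f11 f21) => //.
  - exact: derivative_on_open sg1 U1D oU1 sf1 df11.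
  - exact: derivative_on_open sg1 U2D oU2 sf2 df21.
  - by move=> t; rewrite a1E a2E hornerD hornerN.
have b0 : (b1 - b2)`_i = 0.
  apply: (IHk g2 f12 f22) => //.
  - exact: derivative_on_open sg2 U1D oU1 sf1 df12.
  - exact: derivative_on_open sg2 U2D oU2 sf2 df22.
  - by move=> t; rewrite b1E b2E hornerD hornerN.
have dp : p^`() = v.1 *: (a1 - a2) + v.2 *: (b1 - b2).
  apply: horner_inj => t; rewrite pq derivB !hornerE -dq1E -dq2E a1E a2E b1E b2E; ring.
have /eqP : p^`()`_i = 0 by rewrite dp coefD !coefZ a0 b0 !mulr0 addr0.
by rewrite coef_deriv mulrn_eq0 /= => /eqP.
Qed.

(** Along a line through m the difference of the pieces has degree at most 2r and
    only its term of degree 2r survives, so it is even about m. *)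
Lemma contact_even r (D U1 U2 : set (R * R)) m s f1 f2 v : (0 < r)%N ->
  class_C (2 * r - 1) D s -> D m -> U1 `<=` D -> U2 `<=` D ->
  reaches U1 m -> reaches U2 m ->
  poly_le (2 * r) f1 -> poly_le (2 * r) f2 -> {in U1, s =1 f1} -> {in U2, s =1 f2} ->
  f1 (m - v) - f2 (m - v) = f1 (m + v) - f2 (m + v).
Proof.
move=> r0 Cs Dm U1D U2D rU1 rU2 pf1 pf2 sf1 sf2.
have [f11 [f12 [_ _ _ _ f1P]]] := poly_le_gradient pf1.
have [f21 [f22 [_ _ _ _ f2P]]] := poly_le_gradient pf2.
have [q1 [sq1 q1E _]] := f1P m v; have [q2 [sq2 q2E _]] := f2P m v.
have pE t : f1 (m + t *: v) - f2 (m + t *: v) = (q1 - q2).[t].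
  by rewrite hornerD hornerN q1E q2E.
rewrite -scaleN1r pE -[in RHS](scale1r v) pE !horner_coef.
apply: eq_bigr => i _; have [ir|ri] := leqP i (2 * r - 1).
  by rewrite (contact_coef Cs Dm U1D U2D rU1 rU2 pf1 pf2 sf1 sf2 pE ir) !mul0r.
have := leq_trans (ltn_ord i) (size_polyD _ _); rewrite size_polyN => isz2.
have ile : (i <= 2 * r)%N by rewrite -ltnS (leq_trans isz2)// geq_max sq1.
have -> : nat_of_ord i = (2 * r)%N.
  apply/eqP; rewrite eqn_leq ile /=.
  by move: ri; rewrite subn1 prednK ?muln_gt0.
by rewrite exprM sqrrN !expr1n.
Qed.
End Contact.

(** * Evenness about a line; affine forms *)

Section Lines.
Context {R : realType}.

(** The product of the point reflections about two points of the segment is a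
    translation along the line, so H is invariant under small translations along
    the line, hence under all of them, and the evenness about one point of the
    segment spreads to the whole line. *)
Lemma even_about_line (H : R * R -> R) (w u : R * R) :
  (forall t x, 0 <= t <= 1 -> H (2 *: (w + t *: u) - x) = H x) ->
  forall t x, H (2 *: (w + t *: u) - x) = H x.
Proof.
move=> Hseg.
have Hshift1 t x : 0 <= t <= 1 -> H (x + (2 * t) *: u) = H x.
  move=> t01; rewrite -[RHS](Hseg 0) ?lexx ?ler01// -[RHS](Hseg t)//; congr H.
  by apply: plane_ext; rewrite !coordE; ring.
have Hshift0 t x : 0 <= t -> H (x + (2 * t) *: u) = H x.
  move=> t0; have [n tn] : exists n : nat, t <= n%:R.
    by exists (Num.bound t); exact/ltW/archi_boundP.
  elim: n t t0 x tn => [|n IHn] t t0 x tn.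
    by apply: Hshift1; rewrite t0 (le_trans tn).
  have [t1|t1] := leP t 1; first by apply: Hshift1; rewrite t0.
  rewrite (_ : _ + _ = (x + (2 * (t - 1)) *: u) + (2 * 1) *: u); last first.
    by apply: plane_ext; rewrite !coordE; ring.
  rewrite Hshift1 ?ler01 ?lexx// IHn//; first by rewrite subr_ge0 ltW.
  by rewrite lerBlDr natr1.
have Hshift t x : H (x + (2 * t) *: u) = H x.
  have [t0|t0] := leP 0 t; first exact: Hshift0.
  rewrite -[LHS](Hshift0 (- t)); last by rewrite oppr_ge0 ltW.
  by congr H; apply: plane_ext; rewrite !coordE; ring.
move=> t x; rewrite -[RHS](Hseg 0) ?lexx ?ler01// -[RHS](Hshift t); congr H.
by apply: plane_ext; rewrite !coordE; ring.
Qed.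

Lemma affine_map_line (g : R * R -> R * R) m q t : affine_map g ->
  g (m + t *: (q - m)) = g m + t *: (g q - g m).
Proof.
move=> [a [b [c [a' [b' [c' gE]]]]]]; rewrite !gE.
by apply: plane_ext; rewrite !coordE /=; ring.
Qed.

Lemma affine_map_reflect (g : R * R -> R * R) m x : affine_map g ->
  g (2 *: m - x) = g m - (g x - g m).
Proof.
move=> [a [b [c [a' [b' [c' gE]]]]]]; rewrite !gE.
by apply: plane_ext; rewrite !coordE /=; ring.
Qed.

Definition affine_form (f : R * R -> R) := exists a b c : R,
  forall x, f x = a * x.1 + b * x.2 + c.

Lemma affine_formB f g : affine_form f -> affine_form g ->
  affine_form (fun x => f x - g x).
Proof.
move=> [a [b [c fE]]] [a' [b' [c' gE]]].
by exists (a - a'), (b - b'), (c - c') => x; rewrite fE gE; ring.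
Qed.

Lemma affine_form_comp f h : affine_form f -> affine_map h ->
  affine_form (f \o h).
Proof.
move=> [a [b [c fE]]] [a1 [b1 [c1 [a2 [b2 [c2 hE]]]]]].
exists (a * a1 + b * a2), (a * b1 + b * b2), (a * c1 + b * c2 + c) => x.
by rewrite /= fE hE /=; ring.
Qed.

Lemma affine_form_line f m q t : affine_form f ->
  f (m + t *: (q - m)) = (1 - t) * f m + t * f q.
Proof. by move=> [a [b [c fE]]]; rewrite !fE !coordE; ring. Qed.

Lemma affine_form_continuous f : affine_form f -> continuous f.
Proof.
move=> [a [b [c fE]]] x; rewrite (funext fE).
suff : (a * y.1 + b * y.2 + c) @[y --> x] --> (a * x.1 + b * x.2 + c : R) by [].
apply: cvgD; last exact: cvg_cst.
by apply: cvgD; (apply: cvgM; first exact: cvg_cst);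
  [exact: cvg_fst|exact: cvg_snd].
Qed.

Lemma affine_form_gt0_open f : affine_form f -> open [set x | 0 < f x].
Proof.
move=> /affine_form_continuous cf.
by apply: (@open_comp _ _ f [set y | 0 < y]) => [x _|];
  [exact: cf|exact: open_gt].
Qed.

Lemma affine_form_ge0_measurable f : affine_form f ->
  measurable ([set x | 0 <= f x] :
    set (measurableTypeR R * measurableTypeR R)%type).
Proof.
move=> [a [b [c fE]]].
have := @measurable_affine_form R a b c measurableT _ (measurable_itv `[0, +oo[).
rewrite setTI; congr measurable; apply/seteqP; split=> x /=;
  by rewrite in_itv /= andbT fE.
Qed.
End Lines.

(** * Barycentric coordinates and symmetries of a triangle *)

Section TriangleSymmetries.
Context {R : realType}.
Local Notation plane := (measurableTypeR R * measurableTypeR R)%type.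
Implicit Types (u v w t : R) (x y m : R * R).

Definition cross (v w : R * R) : R := v.1 * w.2 - v.2 * w.1.

Lemma cross_neq0 (p1 p2 p3 : R * R) :
  ~ collinear p1 p2 p3 -> cross (p1 - p3) (p2 - p3) != 0.
Proof.
move=> nc; apply/eqP => c0; apply: nc.
have prop (v w : R * R) : cross v w = 0 -> v != 0 -> exists t, w = t *: v.
  rewrite /cross => vw0 v0; have [v10|v10] := eqVneq v.1 0.
    have v20 : v.2 != 0.
      by apply: contra_neq v0 => v20; apply: plane_ext; rewrite ?v10 ?v20.
    exists (w.2 / v.2); apply: plane_ext; rewrite !coordE ?divfK// v10 mulr0.
    move/eqP: vw0.
    by rewrite v10 mul0r sub0r oppr_eq0 mulf_eq0 (negbTE v20) => /eqP.
  exists (w.1 / v.1); apply: plane_ext; rewrite !coordE ?divfK//.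
  apply: (mulfI v10); move/eqP: vw0; rewrite subr_eq0 => /eqP ->.
  by field.
have [p13|p13] := eqVneq (p1 - p3) 0.
  exists p3, (p2 - p3) => p [[->|->]|->].
  - by exists 0; rewrite scale0r addr0; apply/eqP; rewrite -subr_eq0 p13.
  - by exists 1; rewrite scale1r subrKC.
  - by exists 0; rewrite scale0r addr0.
have [t tE] := prop _ _ c0 p13.
exists p3, (p1 - p3) => p [[->|->]|->].
- by exists 1; rewrite scale1r subrKC.
- by exists t; rewrite -tE subrKC.
- by exists 0; rewrite scale0r addr0.
Qed.

Variables p1 p2 p3 : R * R.
Hypothesis ncol : cross (p1 - p3) (p2 - p3) != 0.
Local Notation T := (triangle p1 p2 p3).

Definition of_bary u v w : R * R := u *: p1 + v *: p2 + w *: p3.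
(** Barycentric coordinates with respect to the triangle, by Cramer's rule. *)
Definition bary1 x := cross (x - p3) (p2 - p3) / cross (p1 - p3) (p2 - p3).
Definition bary2 x := cross (p1 - p3) (x - p3) / cross (p1 - p3) (p2 - p3).
Definition bary3 x := 1 - bary1 x - bary2 x.

Lemma bary_of_bary u v w : u + v + w = 1 ->
  (bary1 (of_bary u v w) = u) * (bary2 (of_bary u v w) = v) * (bary3 (of_bary u v w) = w).
Proof.
move=> uvw; have {uvw} -> : w = 1 - u - v by rewrite -uvw; ring.
have b1 : bary1 (of_bary u v (1 - u - v)) = u.
  rewrite /bary1 (_ : cross (_ - _) _ = u * cross (p1 - p3) (p2 - p3)) ?mulfK//.
  by rewrite /of_bary /cross !coordE; ring.
have b2 : bary2 (of_bary u v (1 - u - v)) = v.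
  rewrite /bary2 (_ : cross (_ - _) _ = v * cross (p1 - p3) (p2 - p3)) ?mulfK//.
  by rewrite /of_bary /cross !coordE; ring.
by rewrite /bary3 b1 b2.
Qed.

Lemma bary_sum x : bary1 x + bary2 x + bary3 x = 1.
Proof. by rewrite /bary3; ring. Qed.

Lemma of_baryK x : of_bary (bary1 x) (bary2 x) (bary3 x) = x.
Proof.
move: ncol; rewrite /of_bary /bary3 /bary1 /bary2 /cross !coordE => nc.
by apply: plane_ext; rewrite !coordE; field.
Qed.

Lemma bary_ind (P : R * R -> Prop) :
  (forall u v w, u + v + w = 1 -> P (of_bary u v w)) -> forall x, P x.
Proof. by move=> Ppt x; rewrite -(of_baryK x); exact/Ppt/bary_sum. Qed.

Lemma bary1_affine : affine_form bary1.
Proof.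
exists ((p2 - p3).2 / cross (p1 - p3) (p2 - p3)).
exists (- (p2 - p3).1 / cross (p1 - p3) (p2 - p3)).
exists (cross (- p3) (p2 - p3) / cross (p1 - p3) (p2 - p3)) => x.
by rewrite /bary1 /cross !coordE; ring.
Qed.

Lemma bary2_affine : affine_form bary2.
Proof.
exists (- (p1 - p3).2 / cross (p1 - p3) (p2 - p3)).
exists ((p1 - p3).1 / cross (p1 - p3) (p2 - p3)).
exists (cross (p1 - p3) (- p3) / cross (p1 - p3) (p2 - p3)) => x.
by rewrite /bary2 /cross !coordE; ring.
Qed.

Lemma bary3_affine : affine_form bary3.
Proof.
apply: affine_formB bary2_affine; apply: affine_formB bary1_affine.
by exists 0, 0, 1 => x; ring.
Qed.

Lemma of_bary_affine f g h : affine_form f -> affine_form g -> affine_form h ->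
  affine_map (fun x => of_bary (f x) (g x) (h x)).
Proof.
move=> [a1 [b1 [c1 fE]]] [a2 [b2 [c2 gE]]] [a3 [b3 [c3 hE]]].
exists (a1 * p1.1 + a2 * p2.1 + a3 * p3.1), (b1 * p1.1 + b2 * p2.1 + b3 * p3.1),
  (c1 * p1.1 + c2 * p2.1 + c3 * p3.1), (a1 * p1.2 + a2 * p2.2 + a3 * p3.2),
  (b1 * p1.2 + b2 * p2.2 + b3 * p3.2), (c1 * p1.2 + c2 * p2.2 + c3 * p3.2) => x.
by apply: plane_ext; rewrite /of_bary fE gE hE !coordE /=; ring.
Qed.

Lemma triangleP x : T x <-> [/\ 0 <= bary1 x, 0 <= bary2 x & 0 <= bary3 x].
Proof.
split=> [[u [v [w [u0 v0 w0 uvw ->]]]]|[u0 v0 w0]].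
  by have [[b1 b2] b3] := bary_of_bary uvw; rewrite b1 b2 b3.
by exists (bary1 x), (bary2 x), (bary3 x); split; rewrite ?bary_sum ?[RHS]of_baryK.
Qed.

Lemma triangle_measurable : measurable (T : set plane).
Proof.
rewrite (_ : T = [set x | 0 <= bary1 x] `&` [set x | 0 <= bary2 x] `&`
    [set x | 0 <= bary3 x]).
  apply: measurableI; first apply: measurableI.
  - exact: affine_form_ge0_measurable bary1_affine.
  - exact: affine_form_ge0_measurable bary2_affine.
  - exact: affine_form_ge0_measurable bary3_affine.
by apply/seteqP; split=> x /=;
  [move/triangleP=> []|move=> [[? ?] ?]; apply/triangleP].
Qed.

(** The affine reflections of the triangle that exchange two vertices; they
    generate its symmetry group, of order 6. *)
Definition swap12 x := of_bary (bary2 x) (bary1 x) (bary3 x).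
Definition swap23 x := of_bary (bary1 x) (bary3 x) (bary2 x).

Lemma swap12_of_bary u v w : u + v + w = 1 -> swap12 (of_bary u v w) = of_bary v u w.
Proof. by move=> uvw; rewrite /swap12 !bary_of_bary. Qed.

Lemma swap23_of_bary u v w : u + v + w = 1 -> swap23 (of_bary u v w) = of_bary u w v.
Proof. by move=> uvw; rewrite /swap23 !bary_of_bary. Qed.

Lemma bary_swap12 x : (bary1 (swap12 x) = bary2 x) *
  (bary2 (swap12 x) = bary1 x) * (bary3 (swap12 x) = bary3 x).
Proof. by rewrite !bary_of_bary//; have := bary_sum x; lra. Qed.

Lemma bary_swap23 x : (bary1 (swap23 x) = bary1 x) *
  (bary2 (swap23 x) = bary3 x) * (bary3 (swap23 x) = bary2 x).
Proof. by rewrite !bary_of_bary//; have := bary_sum x; lra. Qed.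

Lemma swap12K : involutive swap12.
Proof.
by elim/bary_ind => u v w uvw; rewrite !swap12_of_bary// -uvw; ring.
Qed.

Lemma swap23K : involutive swap23.
Proof.
by elim/bary_ind => u v w uvw; rewrite !swap23_of_bary// -uvw; ring.
Qed.

Lemma swap_braid x : swap12 (swap23 (swap12 x)) = swap23 (swap12 (swap23 x)).
Proof.
elim/bary_ind: x => u v w uvw.
rewrite swap12_of_bary// swap23_of_bary; last by rewrite -uvw; ring.
rewrite swap12_of_bary; last by rewrite -uvw; ring.
rewrite swap23_of_bary// swap12_of_bary; last by rewrite -uvw; ring.
by rewrite swap23_of_bary// -uvw; ring.
Qed.

Lemma swap12_affine : affine_map swap12.
Proof. exact: (of_bary_affine bary2_affine bary1_affine bary3_affine). Qed.

Lemma swap23_affine : affine_map swap23.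
Proof. exact: (of_bary_affine bary1_affine bary3_affine bary2_affine). Qed.

Lemma swap12_triangle x : T x -> T (swap12 x).
Proof.
move=> [u [v [w [u0 v0 w0 uvw ->]]]]; rewrite -[tri_point _ _ _ _]/(of_bary u v w).
by rewrite swap12_of_bary//; exists v, u, w; split => //; rewrite -uvw; ring.
Qed.

Lemma swap23_triangle x : T x -> T (swap23 x).
Proof.
move=> [u [v [w [u0 v0 w0 uvw ->]]]]; rewrite -[tri_point _ _ _ _]/(of_bary u v w).
by rewrite swap23_of_bary//; exists u, w, v; split => //; rewrite -uvw; ring.
Qed.

Lemma vertex1E : p1 = of_bary 1 0 0.
Proof. by rewrite /of_bary !scale0r scale1r !addr0. Qed.
Lemma vertex2E : p2 = of_bary 0 1 0.
Proof. by rewrite /of_bary !scale0r scale1r add0r addr0. Qed.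
Lemma vertex3E : p3 = of_bary 0 0 1.
Proof. by rewrite /of_bary !scale0r scale1r !add0r. Qed.

(** The reflection moves x by the multiple bary2 x - bary1 x of p1 - p2, and this
    coefficient drops by 2 along p1 - p2. *)
Lemma swap12_area : area_preserving swap12.
Proof.
have [a [b [c abcE]]] := affine_formB bary2_affine bary1_affine.
have : a * (p1 - p2).1 + b * (p1 - p2).2 = - 2.
  rewrite (_ : _ + _ = (bary2 p1 - bary1 p1) - (bary2 p2 - bary1 p2)).
    by rewrite vertex1E vertex2E !bary_of_bary; ring.
  by rewrite !abcE !coordE; ring.
move/(@area_preserving_reflection _ _ _ _ c); congr area_preserving.
apply/funext => x; rewrite -abcE -{1}(of_baryK x) /swap12 /of_bary.
by apply: plane_ext; rewrite !coordE; ring.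
Qed.

Lemma swap23_area : area_preserving swap23.
Proof.
have [a [b [c abcE]]] := affine_formB bary3_affine bary2_affine.
have : a * (p2 - p3).1 + b * (p2 - p3).2 = - 2.
  rewrite (_ : _ + _ = (bary3 p2 - bary2 p2) - (bary3 p3 - bary2 p3)).
    by rewrite vertex2E vertex3E !bary_of_bary; ring.
  by rewrite !abcE !coordE; ring.
move/(@area_preserving_reflection _ _ _ _ c); congr area_preserving.
apply/funext => x; rewrite -abcE -{1}(of_baryK x) /swap23 /of_bary.
by apply: plane_ext; rewrite !coordE; ring.
Qed.

(** The points whose barycentric coordinates decrease form the corner piece
    <p1, p12, pc> of the split; the other pieces are its images under the
    symmetries of the triangle. *)
Definition chamber : set (R * R) :=
  [set x | [/\ 0 <= bary3 x, bary3 x <= bary2 x & bary2 x <= bary1 x]].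
Definition open_chamber : set (R * R) :=
  [set x | [/\ 0 < bary3 x, bary3 x < bary2 x & bary2 x < bary1 x]].

(** The six symmetries of the triangle and, in the same order, their inverses.
    Beyond index 5 both lists default to the identity, so that statements on
    sym i hold for every natural number i. *)
Definition sym i : R * R -> R * R := nth id
  [:: id; swap12; swap23; swap12 \o swap23; swap23 \o swap12;
      swap12 \o (swap23 \o swap12)] i.
Definition symV i : R * R -> R * R := nth id
  [:: id; swap12; swap23; swap23 \o swap12; swap12 \o swap23;
      swap12 \o (swap23 \o swap12)] i.

Lemma symK i : cancel (sym i) (symV i).
Proof.
move: i => [|[|[|[|[|[|[|i]]]]]]] x; rewrite /sym /symV /= ?nth_nil //.
all: by do ?[rewrite swap12K | rewrite swap23K].
Qed.

Lemma symVK i : cancel (symV i) (sym i).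
Proof.
move: i => [|[|[|[|[|[|[|i]]]]]]] x; rewrite /sym /symV /= ?nth_nil //.
all: by do ?[rewrite swap12K | rewrite swap23K].
Qed.

Lemma sym_closed (P : (R * R -> R * R) -> Prop) : P id -> P swap12 -> P swap23 ->
  (forall g h, P g -> P h -> P (g \o h)) -> forall i, P (sym i).
Proof.
by move=> P1 Pa Pb PM [|[|[|[|[|[|[|i]]]]]]] //=; do ?apply: (PM).
Qed.

Lemma symV_closed (P : (R * R -> R * R) -> Prop) : P id -> P swap12 -> P swap23 ->
  (forall g h, P g -> P h -> P (g \o h)) -> forall i, P (symV i).
Proof.
by move=> P1 Pa Pb PM [|[|[|[|[|[|[|i]]]]]]] //=; do ?apply: (PM).
Qed.

Lemma affine_map_id : affine_map (@id (R * R)).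
Proof.
by exists 1, 0, 0, 0, 1, 0 => x; apply: plane_ext => /=; ring.
Qed.

Lemma sym_affine i : affine_map (sym i).
Proof.
apply: sym_closed; [exact: affine_map_id|exact: swap12_affine|
  exact: swap23_affine|exact: affine_map_comp].
Qed.

Lemma symV_affine i : affine_map (symV i).
Proof.
apply: symV_closed; [exact: affine_map_id|exact: swap12_affine|
  exact: swap23_affine|exact: affine_map_comp].
Qed.

Lemma sym_triangle i x : T x -> T (sym i x).
Proof.
apply: (sym_closed (P := fun g => forall x, T x -> T (g x))) => //.
- exact: swap12_triangle.
- exact: swap23_triangle.
- by move=> g h gT hT y /hT /gT.
Qed.

Lemma symV_triangle i x : T x -> T (symV i x).
Proof.
apply: (symV_closed (P := fun g => forall x, T x -> T (g x))) => //.
- exact: swap12_triangle.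
- exact: swap23_triangle.
- by move=> g h gT hT y /hT /gT.
Qed.

Lemma sym_area i : area_preserving (sym i).
Proof.
apply: sym_closed;
  [|exact: swap12_area|exact: swap23_area|exact: area_preserving_comp].
by split=> //; exact: measurable_id.
Qed.

Lemma chamber_triangle x : chamber x -> T x.
Proof. by move=> [h1 h2 h3]; apply/triangleP; split; lra. Qed.

Lemma open_chamber_chamber x : open_chamber x -> chamber x.
Proof. by move=> [h1 h2 h3]; split; exact: ltW. Qed.

(** A point is brought into the chamber by the symmetry that sorts its barycentric
    coordinates. *)
Lemma triangle_cover x : T x -> exists2 i, (i < 6)%N & chamber (symV i x).
Proof.
pose C u v w := [/\ 0 <= w, w <= v & v <= u].
have sort3 u v w : 0 <= u -> 0 <= v -> 0 <= w -> exists2 i, (i < 6)%N &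
    nth False [:: C u v w; C v u w; C u w v; C v w u; C w u v; C w v u] i.
  move=> u0 v0 w0.
  (* Two of the eight cases are contradictory; their index is arbitrary. *)
  have [uv|vu] := leP u v; have [vw|wv] := leP v w; have [uw|wu] := leP u w;
    [exists 5%N | exists 5%N | exists 3%N | exists 1%N
    |exists 4%N | exists 2%N | exists 0%N | exists 0%N] => //;
    by rewrite /C /=; split; lra.
move=> /triangleP[u0 v0 w0]; have [i i6 Ci] := sort3 _ _ _ u0 v0 w0.
exists i => //; have [[a1 a2] a3] := bary_swap12 x.
have [[b1 b2] b3] := bary_swap23 x.
have [[c1 c2] c3] := bary_swap23 (swap12 x).
move: i i6 Ci => [|[|[|[|[|[|i]]]]]] // _; rewrite /C /chamber /symV /=.
- by rewrite a1 a2 a3.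
- by rewrite b1 b2 b3.
- by rewrite c1 c2 c3 a1 a2 a3.
- have [[d1 d2] d3] := bary_swap12 (swap23 x).
  by rewrite d1 d2 d3 b1 b2 b3.
- have [[d1 d2] d3] := bary_swap12 (swap23 (swap12 x)).
  by rewrite d1 d2 d3 c1 c2 c3 a1 a2 a3.
Qed.

Lemma chamber_measurable i :
  measurable ([set x | chamber (symV i x)] : set plane).
Proof.
have hV f : affine_form f ->
    measurable ([set x | 0 <= f (symV i x)] : set plane).
  move=> af.
  exact: affine_form_ge0_measurable (affine_form_comp af (symV_affine i)).
rewrite (_ : [set x | _] = [set x | 0 <= bary3 (symV i x)] `&`
  [set x | 0 <= bary2 (symV i x) - bary3 (symV i x)] `&`
  [set x | 0 <= bary1 (symV i x) - bary2 (symV i x)]); last first.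
  apply/seteqP; split=> x /=; rewrite /chamber /= !subr_ge0; first by case.
  by move=> [[? ?] ?].
apply: measurableI; first apply: measurableI.
- exact: hV bary3_affine.
- exact: hV (affine_formB bary2_affine bary3_affine).
- exact: hV (affine_formB bary1_affine bary2_affine).
Qed.

End TriangleSymmetries.

(** * Adjacent polynomial pieces of a spline *)

Section SplineSymmetrization.
Context {R : realType}.
Implicit Types (t : R) (x y m : R * R).
Variables p1 p2 p3 : R * R.
Hypothesis ncol : cross (p1 - p3) (p2 - p3) != 0.
Local Notation T := (triangle p1 p2 p3).
Local Notation bary1 := (bary1 p1 p2 p3).
Local Notation bary2 := (bary2 p1 p2 p3).
Local Notation bary3 := (bary3 p1 p2 p3).
Local Notation chamber := (chamber p1 p2 p3).
Local Notation open_chamber := (open_chamber p1 p2 p3).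
Local Notation sym := (sym p1 p2 p3).

Lemma sorted_in_corner_piece (q1 q2 q3 : R * R) (u v w : R) :
  0 <= w -> w <= v -> v <= u -> u + v + w = 1 ->
  triangle q1 (midpoint q1 q2) (barycenter q1 q2 q3) (u *: q1 + v *: q2 + w *: q3).
Proof.
move=> w0 wv vu uvw; exists (u - v), (2 * (v - w)), (3 * w); split; [lra|lra|lra|lra|].
by rewrite /tri_point /midpoint /barycenter; apply: plane_ext;
  rewrite !coordE /=; field.
Qed.

Lemma sorted_in_next_piece (q1 q2 q3 : R * R) (u v w : R) :
  0 <= w -> w <= u -> u <= v -> u + v + w = 1 ->
  triangle (midpoint q1 q2) q2 (barycenter q1 q2 q3) (u *: q1 + v *: q2 + w *: q3).
Proof.
move=> w0 wu uv uvw; exists (2 * (u - w)), (v - u), (3 * w); split; [lra|lra|lra|lra|].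
by rewrite /tri_point /midpoint /barycenter; apply: plane_ext;
  rewrite !coordE /=; field.
Qed.

Lemma sym_chamber_piece i :
  exists2 tau, powell_sabin p1 p2 p3 tau & forall x, chamber x -> tau (sym i x).
Proof.
have rot (q1 q2 q3 : R * R) : barycenter q1 q2 q3 = barycenter q2 q3 q1.
  by rewrite /barycenter; congr (_ *: _); rewrite -addrA addrC.
suff H : exists2 tau, powell_sabin p1 p2 p3 tau &
    forall u v w : R, 0 <= w -> w <= v -> v <= u -> u + v + w = 1 ->
    tau (sym i (of_bary p1 p2 p3 u v w)).
  have [tau Dtau tauP] := H; exists tau => // x [c1 c2 c3].
  by rewrite -(of_baryK ncol x); apply: tauP => //; exact: bary_sum.
have s12 := swap12_of_bary ncol; have s23 := swap23_of_bary ncol.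
have [cor nxt] := (sorted_in_corner_piece, sorted_in_next_piece).
move: i => [|[|[|[|[|[|i]]]]]].
- exists (triangle p1 (midpoint p1 p2) (barycenter p1 p2 p3)); first by do 5 left.
  by move=> u v w *; exact: cor.
- exists (triangle (midpoint p1 p2) p2 (barycenter p1 p2 p3)); first by do 4 left; right.
  move=> u v w ? ? ? uvw; rewrite /sym /= s12//.
  by apply: nxt => //; rewrite -uvw; ring.
- exists (triangle (midpoint p3 p1) p1 (barycenter p3 p1 p2)).
    by rewrite -(rot p2) -(rot p1); right.
  move=> u v w ? ? ? uvw; rewrite /sym /= s23//.
  rewrite (_ : of_bary _ _ _ _ _ _ = v *: p3 + u *: p1 + w *: p2).
    by apply: nxt => //; rewrite -uvw; ring.
  by rewrite /of_bary addrC addrA.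
- exists (triangle p2 (midpoint p2 p3) (barycenter p2 p3 p1)).
    by rewrite -(rot p1); do 3 left; right.
  move=> u v w ? ? ? uvw; rewrite /sym /= s23// s12; last by rewrite -uvw; ring.
  rewrite (_ : of_bary _ _ _ _ _ _ = u *: p2 + v *: p3 + w *: p1); first exact: cor.
  by rewrite /of_bary -addrA addrC.
- exists (triangle p3 (midpoint p3 p1) (barycenter p3 p1 p2)).
    by rewrite -(rot p2) -(rot p1); left; right.
  move=> u v w ? ? ? uvw; rewrite /sym /= s12// s23; last by rewrite -uvw; ring.
  rewrite (_ : of_bary _ _ _ _ _ _ = u *: p3 + v *: p1 + w *: p2); first exact: cor.
  by rewrite /of_bary addrC addrA.
- exists (triangle (midpoint p2 p3) p3 (barycenter p2 p3 p1)).
    by rewrite -(rot p1); do 2 left; right.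
  move=> u v w ? ? ? uvw; rewrite /sym /= s12// s23; last by rewrite -uvw; ring.
  rewrite s12; last by rewrite -uvw; ring.
  rewrite (_ : of_bary _ _ _ _ _ _ = v *: p2 + u *: p3 + w *: p1).
    by apply: nxt => //; rewrite -uvw; ring.
  by rewrite /of_bary -addrA addrC.
- exists (triangle p1 (midpoint p1 p2) (barycenter p1 p2 p3)); first by do 5 left.
  by move=> u v w *; rewrite /sym /= nth_nil; exact: cor.
Qed.

Lemma spline_pieces rho d s i : spline_space rho d T (powell_sabin p1 p2 p3) s ->
  exists f, poly_le d f /\ forall x, chamber x -> s (sym i x) = f (sym i x).
Proof.
move=> [_ piece]; have [tau Dtau tauP] := sym_chamber_piece i.
have [f /polyfun_leW pf sf] := piece tau Dtau.
by exists f; split=> // x /tauP taux; apply: sf; rewrite inE.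
Qed.

Lemma reaches_image (g h : R * R -> R * R) m : affine_map g -> affine_map h ->
  cancel g h -> chamber m -> reaches [set y | open_chamber (h y)] (g m).
Proof.
move=> ag ah gK [m0 m1 m2]; split.
  rewrite (_ : [set y | _] = [set y | 0 < bary3 (h y)] `&`
    [set y | 0 < bary2 (h y) - bary3 (h y)] `&`
    [set y | 0 < bary1 (h y) - bary2 (h y)]); last first.
    apply/seteqP; split=> x /=; rewrite /open_chamber /= !subr_gt0; first by case.
    by move=> [[? ?] ?].
  have oh f : affine_form f -> open [set y | 0 < f (h y)].
    move=> af; exact: affine_form_gt0_open (affine_form_comp af ah).
  apply: openI; first apply: openI.
  - exact: oh (bary3_affine _ _ _).
  - exact: oh (affine_formB (bary2_affine _ _ _) (bary3_affine _ _ _)).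
  - exact: oh (affine_formB (bary1_affine _ _ _) (bary2_affine _ _ _)).
(* Any interior point of the chamber would do for q. *)
pose q := of_bary p1 p2 p3 (1 / 2) (1 / 3) (1 / 6); exists (g q) => t t0 t1 /=.
have [[q1 q2] q3] : (bary1 q = 1 / 2) * (bary2 q = 1 / 3) * (bary3 q = 1 / 6).
  by apply: bary_of_bary => //; lra.
rewrite -affine_map_line// gK /open_chamber /=.
rewrite (affine_form_line _ _ _ (bary1_affine _ _ _)).
rewrite (affine_form_line _ _ _ (bary2_affine _ _ _)).
rewrite (affine_form_line _ _ _ (bary3_affine _ _ _)) q1 q2 q3.
move: (bary1 m) (bary2 m) (bary3 m) m0 m1 m2 => b1 b2 b3 m0 m1 m2.
by split; nra.
Qed.

(** Two adjacent pieces g(chamber) and g(e(chamber)), where e is the reflection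
    about the line w + t u that carries a wall of the chamber.  At each point of
    the common wall the difference H of their polynomials, pulled back by g, is
    even, by contact_even; by even_about_line it is even about each point of the
    line.  Since e x is the mirror image of x about a point of that line,
    namely the midpoint of x and e x, H is invariant under e. *)
Lemma wall_symmetric r s f1 f2 (g h e : R * R -> R * R) (w u : R * R) :
  (0 < r)%N -> class_C (2 * r - 1) T s -> poly_le (2 * r) f1 -> poly_le (2 * r) f2 ->
  affine_map g -> affine_map h -> affine_map e ->
  cancel g h -> cancel h g -> involutive e ->
  (forall x, T x -> T (g x)) -> (forall x, T x -> T (e x)) ->
  (forall x, chamber x -> s (g x) = f1 (g x)) ->
  (forall x, chamber x -> s (g (e x)) = f2 (g (e x))) ->
  (forall t, 0 <= t <= 1 -> chamber (w + t *: u)) ->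
  (forall t, e (w + t *: u) = w + t *: u) ->
  (forall x, exists t, e x = 2 *: (w + t *: u) - x) ->
  forall x, f1 (g (e x)) + f2 (g x) = f1 (g x) + f2 (g (e x)).
Proof.
move=> r0 Cs pf1 pf2 ag ah ae gK hK eK gT eT sf1 sf2 wallc walle refl x.
suff : f1 (g (e x)) - f2 (g (e x)) = f1 (g x) - f2 (g x) by lra.
pose H y := f1 (g y) - f2 (g y).
suff Hl t y : H (2 *: (w + t *: u) - y) = H y by have [t ->] := refl x; exact: Hl.
apply: even_about_line => {}t {}y t01.
set m := w + t *: u; have cm : chamber m by exact: wallc.
rewrite /H affine_map_reflect//.
have := @contact_even R r T [set y | open_chamber (h y)]
  [set y | open_chamber (e (h y))] (g m) s f1 f2 (g y - g m) r0 Cs.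
have oT z : open_chamber z -> T z.
  by move=> /open_chamber_chamber; exact: chamber_triangle.
have -> : g m + (g y - g m) = g y by rewrite addrC subrK.
apply => //.
- exact/gT/(chamber_triangle ncol).
- by move=> z /= /oT /gT; rewrite hK.
- by move=> z /= /oT /eT /gT; rewrite eK hK.
- exact: reaches_image.
- rewrite -[m in g m](walle t).
  apply: (@reaches_image (g \o e) (e \o h)) => //.
  + exact: affine_map_comp.
  + exact: affine_map_comp.
  + by move=> z /=; rewrite gK eK.
- move=> z; rewrite inE /= => /open_chamber_chamber /sf1; rewrite hK //.
- move=> z; rewrite inE /= => /open_chamber_chamber /sf2; rewrite eK hK //.
Qed.

End SplineSymmetrization.

(** * The symmetrized spline and symmetric quadrature rules *)

Section SymmetrizedSpline.
Context {R : realType}.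
Variables p1 p2 p3 : R * R.
Hypothesis ncol : cross (p1 - p3) (p2 - p3) != 0.
Local Notation T := (triangle p1 p2 p3).
Local Notation swap12 := (swap12 p1 p2 p3).
Local Notation swap23 := (swap23 p1 p2 p3).
Local Notation chamber := (chamber p1 p2 p3).
Local Notation sym := (sym p1 p2 p3).
Local Notation symV := (symV p1 p2 p3).

(** A spline s is symmetrized by the constant family, and a family of polynomials
    by using the i-th one on the image of the chamber by the i-th symmetry. *)
Definition symmetrize (s : nat -> R * R -> R) x :=
  \sum_(i <- iota 0 6) s i (sym i x).

Lemma symmetrizeE s x :
  symmetrize s x = s 0%N x + s 1%N (swap12 x) + s 2%N (swap23 x)
  + s 3%N (swap12 (swap23 x)) + s 4%N (swap23 (swap12 x))
  + s 5%N (swap12 (swap23 (swap12 x))).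
Proof. by rewrite /symmetrize /= !big_cons big_nil /sym /=; ring. Qed.

Lemma symmetrize_sym s i x :
  symmetrize (fun=> s) (sym i x) = symmetrize (fun=> s) x.
Proof.
pose S := symmetrize (fun=> s).
apply: (sym_closed (P := fun g => forall x, S (g x) = S x)) => //; rewrite /S.
- by move=> {}x; rewrite !symmetrizeE !swap12K//; ring.
- move=> {}x; rewrite !symmetrizeE !(swap23K ncol).
  by rewrite -(swap_braid ncol x) (swap12K ncol); ring.
- by move=> g h gS hS {}x /=; rewrite gS hS.
Qed.



Section Pieces.
Variables (r : nat) (s : R * R -> R) (f : nat -> R * R -> R).
Hypothesis r0 : (0 < r)%N.
Hypothesis Cs : class_C (2 * r - 1) T s.
Hypothesis pf : forall i, poly_le (2 * r) (f i).
Hypothesis sf : forall i x, chamber x -> s (sym i x) = f i (sym i x).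

(** The wall is the segment from the barycenter w to the midpoint w + u of the edge
    <p1, p2>.  By wall_symmetric the difference of the two adjacent polynomials
    is invariant, and the sum over the two pieces, which swap12 exchanges, is
    invariant as well. *)
Lemma pieces_symmetric12 i j : (forall x, sym i (swap12 x) = sym j x) ->
  forall x, f i (sym i (swap12 x)) + f j (sym j (swap12 x)) =
            f i (sym i x) + f j (sym j x).
Proof.
move=> ij x.
have ji y : sym j (swap12 y) = sym i y by rewrite -ij swap12K.
pose w := of_bary p1 p2 p3 3^-1 3^-1 3^-1.
pose u := of_bary p1 p2 p3 6^-1 6^-1 (- 3^-1).
have wallE t : w + t *: u =
    of_bary p1 p2 p3 (3^-1 + t / 6) (3^-1 + t / 6) (3^-1 - t / 3).
  by rewrite /w /u /of_bary; apply: plane_ext; rewrite !coordE; ring.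
have sum1 (t : R) : (3^-1 + t / 6) + (3^-1 + t / 6) + (3^-1 - t / 3) = 1 by field.
rewrite ji -[sym j x]ij.
apply: (wall_symmetric ncol (g := sym i) (h := symV i) (e := swap12)
  (w := w) (u := u) r0 Cs (pf i) (pf j)) => //.
- exact: sym_affine.
- exact: symV_affine.
- exact: swap12_affine.
- exact: symK.
- exact: symVK.
- exact: (swap12K ncol).
- exact: sym_triangle.
- exact: swap12_triangle.
- exact: sf.
- by move=> y cy; rewrite ij sf.
- move=> t /andP[t0 t1]; rewrite wallE /chamber /= !(bary_of_bary ncol (sum1 t)).
  by split; lra.
- by move=> t; rewrite wallE swap12_of_bary.
- (* The parameter is read off the midpoint of the point and its image. *)
  elim/(bary_ind ncol) => a b c abc; exists (1 - 3 * c).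
  rewrite wallE swap12_of_bary//.
  have -> : c = 1 - a - b by rewrite -abc; ring.
  by rewrite /of_bary; apply: plane_ext; rewrite !coordE; field.
Qed.

(** As before, the wall being now the segment from the barycenter to p1. *)
Lemma pieces_symmetric23 i j : (forall x, sym i (swap23 x) = sym j x) ->
  forall x, f i (sym i (swap23 x)) + f j (sym j (swap23 x)) =
            f i (sym i x) + f j (sym j x).
Proof.
move=> ij x.
have ji y : sym j (swap23 y) = sym i y by rewrite -ij swap23K.
pose w := of_bary p1 p2 p3 3^-1 3^-1 3^-1.
pose u := of_bary p1 p2 p3 (2 / 3) (- 3^-1) (- 3^-1).
have wallE t : w + t *: u =
    of_bary p1 p2 p3 (3^-1 + 2 * t / 3) (3^-1 - t / 3) (3^-1 - t / 3).
  by rewrite /w /u /of_bary; apply: plane_ext; rewrite !coordE; ring.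
have sum1 (t : R) :
    (3^-1 + 2 * t / 3) + (3^-1 - t / 3) + (3^-1 - t / 3) = 1 by field.
rewrite ji -[sym j x]ij.
apply: (wall_symmetric ncol (g := sym i) (h := symV i) (e := swap23)
  (w := w) (u := u) r0 Cs (pf i) (pf j)) => //.
- exact: sym_affine.
- exact: symV_affine.
- exact: swap23_affine.
- exact: symK.
- exact: symVK.
- exact: (swap23K ncol).
- exact: sym_triangle.
- exact: swap23_triangle.
- exact: sf.
- by move=> y cy; rewrite ij sf.
- move=> t /andP[t0 t1]; rewrite wallE /chamber /= !(bary_of_bary ncol (sum1 t)).
  by split; lra.
- by move=> t; rewrite wallE swap23_of_bary.
- elim/(bary_ind ncol) => a b c abc; exists ((3 * a - 1) / 2).
  rewrite wallE swap23_of_bary//.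
  have -> : c = 1 - a - b by rewrite -abc; ring.
  by rewrite /of_bary; apply: plane_ext; rewrite !coordE; field.
Qed.

(** Right multiplication by either reflection pairs up the six symmetries, and the
    contribution of each pair is invariant.  Both reflections generate the group. *)
Lemma symmetrize_pieces_sym i x : symmetrize f (sym i x) = symmetrize f x.
Proof.
pose S := symmetrize f.
apply: (sym_closed (P := fun g => forall x, S (g x) = S x)) => //; rewrite /S.
- move=> {}x.
  have H1 := @pieces_symmetric12 0 1 (fun _ => erefl) x.
  have H2 := @pieces_symmetric12 2 4 (fun _ => erefl) x.
  have H3 := @pieces_symmetric12 3 5 (fun _ => erefl) x.
  rewrite !symmetrizeE.
  by move: H1 H2 H3; rewrite /sym /=; lra.
- move=> {}x.
  have H1 := @pieces_symmetric23 0 2 (fun _ => erefl) x.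
  have H2 := @pieces_symmetric23 1 3 (fun _ => erefl) x.
  have H3 := @pieces_symmetric23 4 5 (fun y => esym (swap_braid ncol y)) x.
  rewrite !symmetrizeE.
  by move: H1 H2 H3; rewrite /sym /=; lra.
- by move=> g h gS hS {}x /=; rewrite gS hS.
Qed.

(** On the chamber the equality holds by the choice of the f i; both sides are
    invariant under the symmetries, which carry the chamber over all of T. *)
Lemma symmetrize_pieces x : T x -> symmetrize (fun=> s) x = symmetrize f x.
Proof.
move=> /(triangle_cover ncol)[i _ ci]; rewrite -(symVK ncol i x).
rewrite symmetrize_sym symmetrize_pieces_sym /symmetrize.
by apply: eq_bigr => j _; exact: sf.
Qed.

Lemma symmetrize_poly : poly_le (2 * r) (symmetrize f).
Proof.
apply: poly_le_sum => i _.
exact: (poly_le_affine (sym_affine _ _ _ i) (pf i)).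
Qed.
End Pieces.
End SymmetrizedSpline.

Section SymmetricQuadrature.
Context {R : realType}.
Variables p1 p2 p3 : R * R.
Hypothesis ncol : cross (p1 - p3) (p2 - p3) != 0.
Local Notation T := (triangle p1 p2 p3).

(** An involution of the duplicate-free list of permutations only reorders it. *)
Lemma permutations_sum_invariant (s : seq R) (sw : seq R -> seq R) (F : seq R -> R) :
  {in permutations s, forall a, sw a \in permutations s} ->
  {in permutations s, forall a, sw (sw a) = a} ->
  \sum_(a <- permutations s) F (sw a) = \sum_(a <- permutations s) F a.
Proof.
move=> swP swK; rewrite -(big_map sw xpredT F); apply: perm_big.
have umap : uniq (map sw (permutations s)).
  rewrite map_inj_in_uniq ?permutations_uniq// => a b /swK aK /swK bK ab.
  by rewrite -aK -bK ab.
apply: uniq_perm => //; first exact: permutations_uniq.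
have sub : {subset map sw (permutations s) <= permutations s}.
  by move=> _ /mapP[a aP ->]; exact: swP.
by have [] := uniq_min_size umap sub; rewrite ?size_map.
Qed.

Lemma perm3 (x y z : R) (a : seq R) : a \in permutations [:: x; y; z] ->
  exists b c d, [/\ a = [:: b; c; d], b + c + d = x + y + z
    & forall a', perm_eq a' a -> a' \in permutations [:: x; y; z]].
Proof.
rewrite mem_permutations => pa; have /= := perm_size pa.
move: a pa => [|b [|c [|d [|? ?]]]] //= pa _; exists b, c, d; split => //.
  have : \sum_(k <- [:: b; c; d]) k = \sum_(k <- [:: x; y; z]) k.
    exact: perm_big.
  by rewrite !big_cons !big_nil !addr0 !addrA.
by move=> a' /perm_trans/(_ pa); rewrite mem_permutations.
Qed.

Lemma orbit_sum_swap12 (x y z : R) (f : R * R -> R) : x + y + z = 1 ->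
  \sum_(a <- permutations [:: x; y; z]) f (swap12 p1 p2 p3 (tri_point p1 p2 p3 a)) =
  \sum_(a <- permutations [:: x; y; z]) f (tri_point p1 p2 p3 a).
Proof.
move=> xyz.
rewrite -[RHS](@permutations_sum_invariant _ (fun a => [:: a`_1; a`_0; a`_2])).
- apply: eq_big_seq => a /perm3[b [c [d [-> bcd _]]]] /=.
  by rewrite (swap12_of_bary ncol) ?bcd.
- move=> a /perm3[b [c [d [-> _]]]]; apply => /=.
  by rewrite (perm_catCA [:: c] [:: b] [:: d]).
- by move=> a /perm3[b [c [d [-> _ _]]]].
Qed.

Lemma orbit_sum_swap23 (x y z : R) (f : R * R -> R) : x + y + z = 1 ->
  \sum_(a <- permutations [:: x; y; z]) f (swap23 p1 p2 p3 (tri_point p1 p2 p3 a)) =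
  \sum_(a <- permutations [:: x; y; z]) f (tri_point p1 p2 p3 a).
Proof.
move=> xyz.
rewrite -[RHS](@permutations_sum_invariant _ (fun a => [:: a`_0; a`_2; a`_1])).
- apply: eq_big_seq => a /perm3[b [c [d [-> bcd _]]]] /=.
  by rewrite (swap23_of_bary ncol) ?bcd.
- move=> a /perm3[b [c [d [-> _]]]]; apply => /=.
  by rewrite perm_cons (perm_catC [:: d] [:: c]).
- by move=> a /perm3[b [c [d [-> _ _]]]].
Qed.

Variables (n0 n1 n2 : nat) (Q : (R * R -> R) -> R).
Hypothesis hQ : symmetric_quadrature_rule p1 p2 p3 n0 n1 n2 Q.

Lemma quadrature_eq f g : (forall x, T x -> f x = g x) -> Q f = Q g.
Proof.
move=> fg; have [_ [w0 [w1 [th1 [w2 [th2 [et2 [_ _ T1 T2 QE]]]]]]]] := hQ.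
rewrite !QE; congr (_ * (_ + _ + _)).
- apply: eq_bigr => i _; rewrite fg//; exists 3^-1, 3^-1, 3^-1.
  by split=> //; rewrite ?invr_ge0//; field.
- apply: eq_bigr => i _; congr (_ * _); apply: eq_big_seq => a aP.
  by apply/fg/(T1 i).
- apply: eq_bigr => i _; congr (_ * _); apply: eq_big_seq => a aP.
  by apply/fg/(T2 i).
Qed.

Lemma quadratureD f g : Q (fun x => f x + g x) = Q f + Q g.
Proof.
have [_ [w0 [w1 [th1 [w2 [th2 [et2 [_ _ _ _ QE]]]]]]]] := hQ.
rewrite !QE -mulrDr; congr (_ * _); 
rewrite [RHS]addrACA [X in _ = X + _]addrACA -!big_split /=.
by congr (_ + _ + _); apply: eq_bigr => i _; rewrite -mulrDr -?big_split.
Qed.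

Lemma quadrature_sum (I : Type) (l : seq I) (f : I -> R * R -> R) :
  Q (fun x => \sum_(i <- l) f i x) = \sum_(i <- l) Q (f i).
Proof.
elim: l => [|i l IHl].
  rewrite big_nil (_ : (fun _ => _) = fun=> 0); last first.
    by apply/funext => x; rewrite big_nil.
  have := quadratureD (fun=> 0) (fun=> 0).
  by rewrite (_ : (fun _ => 0 + 0) = fun=> 0) ?addr0//; lra.
rewrite big_cons -IHl -quadratureD; congr Q.
by apply/funext => x; rewrite big_cons.
Qed.

Lemma quadrature_sym i f : Q (f \o sym p1 p2 p3 i) = Q f.
Proof.
have [_ [w0 [w1 [th1 [w2 [th2 [et2 [_ _ _ _ QE]]]]]]]] := hQ.
have third : 3^-1 + 3^-1 + 3^-1 = 1 :> R by field.
apply: (sym_closed (P := fun g => forall f, Q (f \o g) = Q f)) => //.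
- move=> {}f; rewrite !QE; congr (_ * (_ + _ + _)).
  + by apply: eq_bigr => j _ /=; rewrite (swap12_of_bary ncol).
  + apply: eq_bigr => j _; congr (_ * _); apply: orbit_sum_swap12; ring.
  + apply: eq_bigr => j _; congr (_ * _); apply: orbit_sum_swap12; ring.
- move=> {}f; rewrite !QE; congr (_ * (_ + _ + _)).
  + by apply: eq_bigr => j _ /=; rewrite (swap23_of_bary ncol).
  + apply: eq_bigr => j _; congr (_ * _); apply: orbit_sum_swap23; ring.
  + apply: eq_bigr => j _; congr (_ * _); apply: orbit_sum_swap23; ring.
- by move=> g h gQ hQ' k; rewrite -[RHS]gQ -[RHS]hQ'.
Qed.

End SymmetricQuadrature.

(** * Integration of splines and exactness *)

Section Exactness.
Context {R : realType}.
Local Notation plane := (measurableTypeR R * measurableTypeR R)%type.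
Variables p1 p2 p3 : R * R.
Hypothesis ncol : cross (p1 - p3) (p2 - p3) != 0.
Local Notation T := (triangle p1 p2 p3).
Local Notation chamber := (chamber p1 p2 p3).
Local Notation sym := (sym p1 p2 p3).
Local Notation symV := (symV p1 p2 p3).
Variables (d : nat) (s : R * R -> R) (f : nat -> R * R -> R).
Hypothesis pf : forall i, poly_le d (f i).
Hypothesis sf : forall i x, chamber x -> s (sym i x) = f i (sym i x).

Lemma eq_piece i x : chamber (symV i x) -> s x = f i x.
Proof. by move=> ci; have := sf i ci; rewrite (symVK ncol). Qed.

Lemma piecewise_poly_measurable : measurable_fun (T : set plane) (s : plane -> R).
Proof.
have -> : T = \bigcup_i [set x | chamber (symV i x)].
  apply/seteqP; split=> [x /(triangle_cover ncol)[i _ ci]|x [i _ /= ci]].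
    by exists i.
  by rewrite -(symVK ncol i x); apply/sym_triangle/(chamber_triangle ncol).
apply/measurable_fun_bigcup => [|i]; first exact: chamber_measurable.
apply: (@eq_measurable_fun _ _ _ _ _ (f i)).
  by move=> x; rewrite inE => /eq_piece.
exact: measurable_funTS (poly_le_measurable (pf i)).
Qed.

Lemma piecewise_poly_bounded : exists M, forall x, T x -> `|s x| <= M.
Proof.
have /choice[M fM] : forall i, exists M, forall x, T x -> `|f i x| <= M.
  by move=> i; exact: poly_le_bounded (pf i).
exists (\sum_(i < 6) M i) => x Tx; have [i i6 ci] := triangle_cover ncol Tx.
rewrite (eq_piece ci) (bigD1 (Ordinal i6)) //= (le_trans (fM i x Tx))// lerDl.
by apply: sumr_ge0 => j _; exact: le_trans (normr_ge0 _) (fM j x Tx).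
Qed.

Lemma piecewise_poly_integrable i : (lebesgue2 T < +oo)%E ->
  (@lebesgue2_measure R).-integrable T (fun x : plane => (s (sym i x))%:E).
Proof.
move=> Toof; have [M sM] := piecewise_poly_bounded.
apply: (@measurable_bounded_integrable _ plane R (@lebesgue2_measure R)
   (fun x : plane => s (sym i x) : R) T) => //.
- exact: triangle_measurable.
- apply: (@measurable_comp _ _ _ plane plane _ T s T (sym i)).
  + exact: triangle_measurable.
  + by move=> _ [x Tx <-]; exact: sym_triangle.
  + exact: piecewise_poly_measurable.
  + exact: measurable_funTS (affine_map_measurable (sym_affine p1 p2 p3 i)).
- exists M; split; first exact: num_real.
  move=> N MN x Tx; apply: le_trans (sM _ _) (ltW MN).
  exact: sym_triangle.
Qed.

Lemma integral_sym i : (\int[lebesgue2]_(x in T) (s (sym i x))%:E =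
  \int[lebesgue2]_(x in T) (s x)%:E)%E.
Proof.
rewrite [RHS](integral_area_preserving (sym_area ncol i)).
- rewrite (_ : _ @^-1` _ = T)//; apply/seteqP; split=> x /=.
    by move=> /(symV_triangle ncol i); rewrite symK.
  exact: sym_triangle.
- exact: triangle_measurable.
- exact: piecewise_poly_measurable.
Qed.
End Exactness.

(** Exactness on the constant 1 says that the area is a real number. *)
Lemma exact_lebesgue2_lty (R : realType) (p1 p2 p3 : R * R) d Q :
  cross (p1 - p3) (p2 - p3) != 0 ->
  exact_on (triangle p1 p2 p3) Q (polyfun_le d) ->
  (lebesgue2 (triangle p1 p2 p3) < +oo)%E.
Proof.
move=> ncol exQ.
have := exQ _ (polyfun_le_cst d 1).
have -> : (\int[lebesgue2]_(x in triangle p1 p2 p3) 1%:E =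
    lebesgue2 (triangle p1 p2 p3))%E.
  rewrite (@integral_cst _ _ _ (@lebesgue2_measure R)) ?mul1e//.
  exact: triangle_measurable.
by move=> <-; exact: ltry.
Qed.

Theorem theorem4p4 (R : realType) (r : nat) (p1 p2 p3 : (R * R)%type)
    (n0 n1 n2 : nat) (Q : (R * R -> R) -> R) :
  (1 <= r)%N ->
  ~ collinear p1 p2 p3 ->
  symmetric_quadrature_rule p1 p2 p3 n0 n1 n2 Q ->
  exact_on (triangle p1 p2 p3) Q (polyfun_le (2 * r)) ->
  exact_on (triangle p1 p2 p3) Q
    (spline_space (2 * r - 1) (2 * r) (triangle p1 p2 p3)
       (powell_sabin p1 p2 p3)).
Proof.
move=> r1 /cross_neq0 ncol hQ exQ s hs.
have Tfin := exact_lebesgue2_lty ncol exQ.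
have /choice[f fP] i := spline_pieces ncol i hs.
have pf i : poly_le (2 * r) (f i) by have [] := fP i.
have sf i : forall x, chamber p1 p2 p3 x ->
    s (sym p1 p2 p3 i x) = f i (sym p1 p2 p3 i x) by have [] := fP i.
have symE := symmetrize_pieces ncol r1 hs.1 pf sf.
have intS i := piecewise_poly_integrable ncol pf sf i Tfin.
have intE :
    (\int[lebesgue2]_(x in triangle p1 p2 p3) (symmetrize p1 p2 p3 f x)%:E =
    \sum_(i <- iota 0 6) \int[lebesgue2]_(x in triangle p1 p2 p3) (s x)%:E)%E.
  transitivity (\int[lebesgue2]_(x in triangle p1 p2 p3)
      (\sum_(i <- iota 0 6) (s (sym p1 p2 p3 i x))%:E))%E.
    apply: eq_integral => x; rewrite inE => /symE <-.
    by rewrite /symmetrize sumEFin.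
  rewrite (@integral_sum _ _ _ (@lebesgue2_measure R)) //; last first.
    exact: triangle_measurable.
  by apply: eq_bigr => i _; exact: (integral_sym ncol pf sf).
have := exQ _ (poly_le_polyfun (symmetrize_poly p1 p2 p3 pf)).
rewrite -(quadrature_eq hQ symE) /symmetrize (quadrature_sum hQ).
under eq_bigr do rewrite (quadrature_sym ncol hQ).
have fins : (\int[lebesgue2]_(x in triangle p1 p2 p3) (s x)%:E)%E \is a fin_num.
  (* The symmetry of index 0 is the identity. *)
  exact: (integrable_fin_num (triangle_measurable ncol) (intS 0%N)).
rewrite intE -(fineK fins) sumEFin => -[].
rewrite /= !big_cons !big_nil => eq6; congr EFin; lra.
Qed.
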